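(* Let $s$ be a positive integer, and let $X$ denote the size of a partition chosen uniformly at random from the set of $(s,s+1)$-core partitions. Then the seventh moment of $X$ about its mean is $$\mathbf{E}\big[(X-\mathbf{E}[X])^7\big]=\frac{1}{149448499200}\, s^2(s-1)(s-2)(2s+1)(s+1)^2\,P(s),$$ where $$\begin{aligned}P(s)={}&124496s^{14}-527660s^{13}-127268s^{12}+2133077s^{11}+1565655s^{10}-3928575s^9-7848989s^8\\&-3573289s^7+7257797s^6+16741975s^5+16528197s^4+3583272s^3-67819248s^2-18541440s+138620160.\end{aligned}$$
   Context: A partition is a non-increasing finite sequence of positive integers $\lambda=(\lambda_1,\dots,\lambda_k)$, $k\ge 0$ (the empty partition is allowed); its size is $\lambda_1+\dots+\lambda_k$. Its Ferrers diagram consists of the cells $(i,j)$ with $1\le i\le k$, $1\le j\le\lambda_i$. The hook length of cell $(i,j)$ is $\lambda_i-j+\lambda'_j-i+1$, where $\lambda'$ is the conjugate partition ($\lambda'_j$ = number of $i$ with $\lambda_i\ge j$). A partition is an $s$-core if no cell has hook length equal to $s$, and an $(s,t)$-core partition if it is simultaneously an $s$-core and a $t$-core. The set of $(s,s+1)$-core partitions is finite, and it is given the uniform probability distribution. *)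

(* Defs.v *)
From HB Require Import structures.
From mathcomp Require Import all_boot all_order all_algebra finmap.
From mathcomp Require Import classical_sets cardinality.

Set Implicit Arguments.
Unset Strict Implicit.
Unset Printing Implicit Defensive.

Import Order.TTheory GRing.Theory Num.Theory.
Local Open Scope ring_scope.

Definition is_partition (la : seq nat) : bool :=
  sorted geq la && all (leq 1) la.

Definition partition_size (la : seq nat) : nat := sumn la.

(* Rows, columns and cells are numbered from 1; [part la i] is 0 for i > k. *)
Definition part (la : seq nat) (i : nat) : nat := nth 0%N la i.-1.

Definition conj_part (la : seq nat) (j : nat) : nat := count (leq j) la.

Definition in_diagram (la : seq nat) (i j : nat) : bool :=
  [&& 1 <= i, i <= size la, 1 <= j & j <= part la i]%N.

(* On the cells of a partition neither subtraction truncates. *)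
Definition hook_length (la : seq nat) (i j : nat) : nat :=
  ((part la i - j) + (conj_part la j - i) + 1)%N.

Definition is_core (s : nat) (la : seq nat) : Prop :=
  forall i j : nat, in_diagram la i j -> hook_length la i j <> s.

Definition core_partitions (s t : nat) : set (seq nat) :=
  [set la | is_partition la /\ is_core s la /\ is_core t la]%classic.

(* Expectation of f under the uniform distribution on A; meaningful for A
   finite and nonempty, since [fset_set] of an infinite set is empty. *)
Definition uniform_expectation (T : choiceType) (A : set T) (f : T -> rat) : rat :=
  (\sum_(x <- fset_set A) f x) / (#|` fset_set A|)%:R.

Definition central_moment (T : choiceType) (A : set T) (X : T -> rat) (n : nat) : rat :=
  uniform_expectation A (fun x => (X x - uniform_expectation A X) ^+ n).

Definition seventh_moment_poly (s : rat) : rat :=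
  124496%:R * s ^+ 14 - 527660%:R * s ^+ 13 - 127268%:R * s ^+ 12
  + 2133077%:R * s ^+ 11 + 1565655%:R * s ^+ 10 - 3928575%:R * s ^+ 9
  - 7848989%:R * s ^+ 8 - 3573289%:R * s ^+ 7 + 7257797%:R * s ^+ 6
  + 16741975%:R * s ^+ 5 + 16528197%:R * s ^+ 4 + 3583272%:R * s ^+ 3
  - 67819248%:R * s ^+ 2 - 18541440%:R * s + 138620160%:R.

(* Main.v *)
Require Import Defs.
From Stdlib Require Import ZArith.
From HB Require Import structures.
From mathcomp Require Import all_boot all_order all_algebra finmap.
From mathcomp Require Import classical_sets cardinality.
From mathcomp Require Import zify ring lra ssrZ.
From mathcomp.algebra_tactics Require common.
Import Order.TTheory GRing.Theory Num.Theory.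
Local Open Scope ring_scope.

Set Implicit Arguments.
Unset Strict Implicit.
Unset Printing Implicit Defensive.

Delimit Scope Z_scope with stdZ.

(** Beta numbers turn the (s,s+1)-cores into the words w with s up steps +(s+1)
    and s+1 down steps -s whose heights stay nonnegative, and the size of the core
    into (1/2) Var(heights of w) up to a constant. For arbitrary s and t this
    variance is a function on the words with s steps +t and t steps -s that is
    invariant under rotation and under exchanging the two letters. By the cycle
    lemma the moment over the cores is therefore the moment over all words, and
    the moment F_k(s,t) of order k over all words is symmetric in s and t.

    For fixed s, writing words as compositions of t into s parts shows that F_k(s,t)
    is a polynomial in t of degree at most 2k, and an Ehrhart-type reciprocity
    (replacing each part z by -1-z) gives F_k(s,-s-t) = F_k(s,t). Such a polynomial
    is determined by its values at t = 0, ..., k; by symmetry F_k is determined by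
    its values for s, t <= k. For k = 1 this yields the mean, and for k = 7 a finite
    computation identifies F_7 with an explicit polynomial in s^2+st+t^2 and
    st(s+t), which is evaluated at t = s+1. *)

(** * Words with given numbers of letters *)

(* [true] is an up step, [false] a down step. *)
Fixpoint words (u : nat) : nat -> seq (seq bool) :=
  match u with
  | 0 => fun d => [:: nseq d false]
  | u'.+1 => fix words_u d :=
      match d with
      | 0 => [seq rcons w true | w <- words u' 0%N]
      | d'.+1 => [seq rcons w true | w <- words u' d] ++
                 [seq rcons w false | w <- words_u d']
      end
  end.

Lemma mem_words u d w :
  (w \in words u d) = (count id w == u) && (count negb w == d).
Proof.
have inj_rcons b : injective (fun w : seq bool => rcons w b).
  by move=> w1 w2 /rcons_inj [].
have rconsN b b' (l : seq (seq bool)) w' :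
    (rcons w' b \in [seq rcons x b' | x <- l]) = (b == b') && (w' \in l).
  apply/mapP/andP => [[x xl /rcons_inj [-> ->]]|[/eqP-> w'l]] //.
  by exists w'.
have nilN b (l : seq (seq bool)) : ([::] \in [seq rcons x b | x <- l]) = false.
  by apply/negbTE/mapP => -[[|? ?]].
have base w' d' : (w' \in words 0 d') = (count id w' == 0%N) && (count negb w' == d').
  rewrite inE; apply/eqP/andP => [->|[]].
    by rewrite !count_nseq mul1n eqxx.
  elim: w' d' => [|[] w' IH] d' //= h /eqP <- //.
  by rewrite add1n {1}(IH _ h (eqxx _)).
elim/last_ind: w u d => [|w b IH] [|u] [|d]; rewrite ?base //.
- by rewrite /= nilN.
- by rewrite /= mem_cat !nilN.
- rewrite [words _ _]/= rconsN IH -!cats1 !count_cat /=.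
  by case: b => /=; lia.
- rewrite [words _ _]/= mem_cat !rconsN -/words -/(words u.+1 d) !IH -!cats1 !count_cat /=.
  by case: b => /=; lia.
Qed.

Lemma uniq_words u d : uniq (words u d).
Proof.
have inj_rcons b : injective (fun w : seq bool => rcons w b).
  by move=> w1 w2 /rcons_inj [].
elim: u d => [//|u IHu]; elim=> [|d IHd].
  by rewrite /= map_inj_uniq.
rewrite [words _ _]/= cat_uniq !map_inj_uniq // IHu -/(words u.+1 d) IHd andbT /=.
apply/hasPn => w /mapP [w1 _ ->]; apply/mapP => -[w2 _ /rcons_inj []] //.
Qed.

Lemma big_words_rcons (F : seq bool -> rat) u d :
  \sum_(w <- words u.+1 d.+1) F w =
  \sum_(w <- words u d.+1) F (rcons w true) +
  \sum_(w <- words u.+1 d) F (rcons w false).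
Proof. by rewrite [words _ _]/= big_cat !big_map. Qed.

Lemma size_words u d : size (words u d) = 'C(u + d, u).
Proof.
elim: u d => [|u IHu]; first by move=> d; rewrite bin0.
elim=> [|d IHd]; first by rewrite /= size_map IHu !addn0 !binn.
rewrite [words _ _]/= size_cat !size_map IHu -/(words u.+1 d) IHd.
by rewrite (addSnnS u d) [in RHS]addSn binS addnC.
Qed.

Lemma size_in_words u d w : w \in words u d -> size w = (u + d)%N.
Proof.
rewrite mem_words => /andP [/eqP <- /eqP <-].
by rewrite -(count_predC id).
Qed.

Lemma count_rot (T : Type) (a : pred T) i (w : seq T) : count a (rot i w) = count a w.
Proof. by rewrite /rot count_cat addnC -count_cat cat_take_drop. Qed.

Lemma perm_words_rot u d i : perm_eq [seq rot i w | w <- words u d] (words u d).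
Proof.
have inj : injective (@rot bool i) by apply: rot_inj.
apply: uniq_perm; rewrite ?map_inj_uniq ?uniq_words // => w.
rewrite -{1}(rotrK i w) mem_map // !mem_words.
by rewrite -(count_rot id i) -(count_rot negb i) rotrK.
Qed.

Lemma perm_words_neg u d : perm_eq [seq map negb w | w <- words u d] (words d u).
Proof.
have negK : involutive (map negb).
  by move=> w; rewrite -map_comp map_id_in // => b _ /=; rewrite negbK.
apply: uniq_perm; rewrite ?map_inj_uniq ?uniq_words //; first exact: (inv_inj negK).
move=> w; rewrite -{1}(negK w) mem_map; last exact: (inv_inj negK).
rewrite !mem_words !count_map andbC; congr (_ && _); congr (_ == _); apply: eq_count => b //=.
by rewrite negbK.
Qed.

Lemma rot_words u d i w : (rot i w \in words u d) = (w \in words u d).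
Proof. by rewrite !mem_words !count_rot. Qed.

(** Double counting of the pairs formed by a word and a rotation of it satisfying [Q]. It serves
    twice: for the words that begin with an up step, and for the Dyck words, where [q] is 1. *)
Lemma sum_rotations (f : seq bool -> rat) (Q : pred (seq bool)) u d q :
  {in words u d, forall w, f (rot 1 w) = f w} ->
  {in words u d, forall w, \sum_(i < u + d) (Q (rot i w) : nat) = q}%N ->
  (u + d)%:R * \sum_(w <- words u d | Q w) f w = q%:R * \sum_(w <- words u d) f w.
Proof.
move=> frot Qcount.
have frotn i w : w \in words u d -> f (rot i w) = f w.
  move=> ww; elim: i => [|i IH]; first by rewrite rot0.
  case: (ltnP i (size w)) => [ltiw|leiw].
    by rewrite -add1n rotD ?add1n // frot ?rot_words.
  by rewrite rot_oversize // ltnW.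
rewrite mulr_natl -[X in _ *+ X]card_ord -sumr_const.
rewrite [RHS](_ : _ = \sum_(w <- words u d) \sum_(i < u + d) (Q (rot i w))%:R * f (rot i w)).
  rewrite [RHS]exchange_big /=; apply: eq_big => [i|i _] //.
  rewrite -(perm_big _ (perm_words_rot u d i)) /= big_map.
  by rewrite [LHS]big_mkcond; apply: eq_bigr => w _; case: (Q _); rewrite ?mul1r ?mul0r.
rewrite mulr_sumr; apply: eq_big_seq => w ww; rewrite -(Qcount w ww) natr_sum mulr_suml.
by apply: eq_bigr => i _; rewrite frotn.
Qed.

Lemma count_head_rot (a : pred bool) (w : seq bool) :
  (\sum_(i < size w) (if rot i w is b :: _ then a b else false : nat) = count a w)%N.
Proof.
rewrite -sum1_count [RHS]big_mkcond (big_nth false) big_mkord; apply: eq_bigr => i _.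
rewrite /rot (drop_nth false) //=; by case: (a _).
Qed.

(** * Polynomiality and reciprocity of sums over words *)

(** The falling factorial X(X-1)...(X-k+1). *)
Fixpoint fall_poly (k : nat) : {poly rat} :=
  if k is k'.+1 then fall_poly k' * ('X - k'%:R%:P) else 1.

Lemma fall_poly_monic k : fall_poly k \is monic /\ size (fall_poly k) = k.+1.
Proof.
elim: k => [|k [mk sk]] /=; first by rewrite monic1 size_poly1.
by rewrite monicMl // monicXsubC size_Mmonic ?monicXsubC ?monic_neq0 // sk size_XsubC addn2.
Qed.

Lemma fall_poly_shift k :
  'X * (fall_poly k \Po ('X - 1)) = fall_poly k * ('X - k%:R%:P).
Proof.
elim: k => [|k IH] /=; first by rewrite comp_polyC polyC0 subr0 mulrC.
rewrite comp_polyM mulrA IH comp_polyB comp_polyX comp_polyC -natr1 polyCD polyC1.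
by rewrite -!mulrA; congr (_ * (_ * _)); rewrite opprD addrA addrAC.
Qed.

(* The operator on the right is diagonal in the basis [fall_poly]. *)
Lemma backward_difference_onto n (q : {poly rat}) :
  exists2 p : {poly rat}, (size p <= size q)%N &
  n.+1%:R *: q = (n.+1%:R%:P + 'X) * p - 'X * (p \Po ('X - 1)).
Proof.
move: (leqnn (size q)); move: {2}(size q) => k; elim: k q => [|k IH] q hq.
  move: hq; rewrite leqn0 size_poly_eq0 => /eqP->.
  by exists 0; rewrite ?comp_poly0 // scaler0 !mulr0 subr0.
have [leqk|ltkq] := leqP (size q) k; first exact: IH.
have sq : size q = k.+1 by apply/eqP; rewrite eqn_leq hq.
have [mf sf] := fall_poly_monic k.
pose a := q`_k.
have sr : (size (q - a *: fall_poly k)%R <= k)%N.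
  apply/leq_sizeP => j; rewrite leq_eqVlt => /orP [/eqP <-|ltkj].
    rewrite coefB coefZ; have := mf; rewrite monicE lead_coefE sf => /eqP ->.
    by rewrite mulr1 subrr.
  by rewrite coefB coefZ !nth_default ?sf ?sq // mulr0 subr0.
have [p sp Hp] := IH _ sr.
(* By [fall_poly_shift] the operator multiplies [fall_poly k] by n+1+k, which is nonzero; [c] is the
   leading term divided by this eigenvalue. *)
pose c : rat := a * n.+1%:R / (n.+1 + k)%:R.
exists (p + c *: fall_poly k).
  rewrite (leq_trans (size_polyD _ _)) // geq_max sq leqW ?(leq_trans sp) //.
  by rewrite (leq_trans (size_scale_leq _ _)) ?sf.
have -> : n.+1%:R *: q = n.+1%:R *: (q - a *: fall_poly k) + (n.+1%:R * a) *: fall_poly k.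
  by rewrite scalerBr scalerA subrK.
rewrite Hp comp_polyD comp_polyZ !mulrDr -!scalerAr fall_poly_shift.
have -> : n.+1%:R * a = c * (n.+1 + k)%:R.
  by rewrite /c mulfVK 1?mulrC // pnatr_eq0 addSn.
rewrite -!mul_polyC polyCM natrD polyCD.
by ring.
Qed.

(** Encodes a word as the weakly increasing sequence of the numbers of down steps preceding its up
    steps; [d] offsets the count. *)
Fixpoint falses_before (d : nat) (w : seq bool) : seq nat :=
  match w with
  | [::] => [::]
  | true :: w' => d :: falses_before d w'
  | false :: w' => falses_before d.+1 w'
  end.

Lemma size_falses_before d w : size (falses_before d w) = count id w.
Proof. by elim: w d => [|[] w IH] d //=; rewrite IH. Qed.

Lemma falses_before_rcons d w b :
  falses_before d (rcons w b) =
  falses_before d w ++ (if b then [:: (d + count negb w)%N] else [::]).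
Proof.
elim: w d => [|[] w IH] d /=; first by case: b; rewrite ?addn0.
  by rewrite IH.
by rewrite IH add1n addSnnS.
Qed.

(* [node false n m] and [node true n m] are the two arguments exchanged by
   the reciprocity m <-> -(n+1)-m. *)
Definition node (b : bool) (n m : nat) : rat :=
  if b then - n.+1%:R - m%:R else m%:R.

Definition profile (b : bool) (w : seq bool) (i : nat) : rat :=
  node b i (nth 0%N (falses_before 0 w) i).

Lemma profile_rcons b w c i :
  (i < count id w)%N -> profile b (rcons w c) i = profile b w i.
Proof.
by move=> lt_i; rewrite /profile falses_before_rcons nth_cat size_falses_before lt_i.
Qed.

Lemma profile_last b w : profile b (rcons w true) (count id w) = node b (count id w) (count negb w).
Proof.
by rewrite /profile falses_before_rcons nth_cat size_falses_before ltnn subnn add0n.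
Qed.

(** Splitting off the last letter, the sum for n+1 up steps satisfies a first-order difference
    equation in m whose right-hand side is the sum for n. Divided by the binomials, it is the
    equation solved by [backward_difference_onto]. One [p] serves both values of [b]: this is the
    reciprocity. *)
Lemma sum_monomial_words (r : nat -> nat) n :
  exists2 p : {poly rat}, (size p <= (\sum_(i < n) r i).+1)%N &
  forall b m, \sum_(w <- words n m) \prod_(i < n) profile b w i ^+ r i =
    p.[node b n m] * 'C(n + m, n)%:R.
Proof.
elim: n => [|n [p0 sp0 IH]].
  exists 1; first by rewrite size_poly1.
  by move=> b m; rewrite /= big_seq1 big_ord0 bin0 hornerC mulr1.
have [p sp Hp] := backward_difference_onto n ('X^(r n) * p0).
exists p.
  rewrite (leq_trans sp) // (leq_trans (size_polyMleq _ _)) // size_polyXn big_ord_recr /=.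
  by rewrite addnC -addSn leq_add2r.
pose q := 'X^(r n) * p0.
(* For [b = true], x = -(n+1)-m turns n+1+x into -m and -x into n+1+m, so the two terms of the
   operator trade places. At m = 0 the coefficient m cancels the term with the truncated [m.-1]. *)
have Hq b m : n.+1%:R * q.[node b n m] =
    (n.+1 + m)%:R * p.[node b n.+1 m] - m%:R * p.[node b n.+1 m.-1].
  have Hx x : n.+1%:R * q.[x] = (n.+1%:R + x) * p.[x] - x * p.[x - 1].
    by rewrite -hornerZ Hp !hornerE /= horner_comp !hornerE.
  rewrite Hx /node; case: b.
    case: m => [|m] /=; last first.
      have -> : - n.+2%:R - m%:R = - n.+1%:R - m.+1%:R :> rat by rewrite -!natr1; ring.
      have -> : - n.+2%:R - m.+1%:R = - n.+1%:R - m.+1%:R - 1 :> rat by rewrite -!natr1; ring.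
      by rewrite natrD; ring.
    have -> : - n.+2%:R - 0%:R = - n.+1%:R - 0%:R - 1 :> rat by rewrite -!natr1; ring.
    by rewrite addn0; ring.
  case: m => [|m] /=; first by rewrite addn0; ring.
  have -> : m.+1%:R - 1 = m%:R :> rat by rewrite -natr1 addrK.
  by rewrite natrD.
have stepT b m : \sum_(w <- words n m) \prod_(i < n.+1) profile b (rcons w true) i ^+ r i
    = q.[node b n m] * 'C(n + m, n)%:R.
  rewrite /q hornerM hornerXn -mulrA -IH mulr_sumr; apply: eq_big_seq => w.
  rewrite mem_words => /andP [/eqP wn /eqP wm].
  have := profile_last b w; rewrite wn wm => last_w.
  rewrite big_ord_recr /= mulrC last_w; congr (_ * _).
  by apply: eq_bigr => i _; rewrite profile_rcons ?wn.
have stepF b m : \sum_(w <- words n.+1 m) \prod_(i < n.+1) profile b (rcons w false) i ^+ r i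
    = \sum_(w <- words n.+1 m) \prod_(i < n.+1) profile b w i ^+ r i.
  apply: eq_big_seq => w; rewrite mem_words => /andP [/eqP wn _].
  by apply: eq_bigr => i _; rewrite profile_rcons ?wn.
move=> b; elim=> [|m IHm].
  rewrite /= big_map stepT !addn0 !binn !mulr1.
  have := Hq b 0%N; rewrite mul0r subr0 addn0.
  by apply: mulfI; rewrite pnatr_eq0.
rewrite big_words_rcons stepT stepF IHm.
apply: (@mulfI _ n.+1%:R); first by rewrite pnatr_eq0.
rewrite mulrDr mulrA Hq /=.
have B1 : n.+1%:R * 'C(n.+1 + m, n.+1)%:R = m.+1%:R * 'C(n + m.+1, n)%:R :> rat.
  rewrite -!natrM addSnnS mul_bin_left; congr (_ * _)%:R; lia.
have B2 : n.+1%:R * 'C(n.+1 + m.+1, n.+1)%:R = (n.+1 + m.+1)%:R * 'C(n + m.+1, n)%:R :> rat.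
  by rewrite -!natrM -mul_bin_diag.
rewrite (mulrCA n.+1%:R p.[_]) B1 (mulrCA n.+1%:R p.[_]) B2.
by ring.
Qed.

(** * Polynomial functions of t and of a profile *)

(** Polynomials of total degree at most d in t and the first n values of S, where t counts as degree
    1. The closure rules carry the degree bound without multivariate polynomials, and [PolyfunExt]
    identifies pointwise equal functions. *)
Inductive polyfun (n : nat) : nat -> (rat -> (nat -> rat) -> rat) -> Prop :=
| PolyfunMonomial (r : nat -> nat) :
    polyfun n (\sum_(i < n) r i) (fun _ S => \prod_(i < n) S i ^+ r i)
| PolyfunAdd d f g : polyfun n d f -> polyfun n d g ->
    polyfun n d (fun t S => f t S + g t S)
| PolyfunScale d c f : polyfun n d f -> polyfun n d (fun t S => c * f t S)
| PolyfunVar d f : polyfun n d f -> polyfun n d.+1 (fun t S => t * f t S)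
| PolyfunLe d e f : (d <= e)%N -> polyfun n d f -> polyfun n e f
| PolyfunExt d f g : (forall t S, f t S = g t S) -> polyfun n d f -> polyfun n d g.

Arguments PolyfunMonomial : clear implicits.

Lemma polyfun_cst n c : polyfun n 0 (fun _ _ => c).
Proof.
have := PolyfunMonomial n (fun=> 0%N); rewrite big1 // => H.
apply: (PolyfunExt _ (PolyfunScale c H)) => t S.
by rewrite big1 ?mulr1.
Qed.

Lemma polyfun_var n : polyfun n 1 (fun t _ => t).
Proof.
by apply: (PolyfunExt _ (PolyfunVar (polyfun_cst n 1))) => t S; rewrite mulr1.
Qed.

Lemma polyfun_coord n (i : 'I_n) : polyfun n 1 (fun _ S => S i).
Proof.
have := PolyfunMonomial n (fun j => (j == i :> nat) : nat).
rewrite (bigD1 i) //= eqxx big1 ?addn0 => [H|j /negbTE ji].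
  2: by rewrite -val_eqE in ji; rewrite ji.
apply: (PolyfunExt _ H) => t S; rewrite (bigD1 i) //= eqxx expr1 big1 ?mulr1 // => j /negbTE ji.
by rewrite -val_eqE /= in ji; rewrite ji.
Qed.

Lemma polyfunM n d e f g :
  polyfun n d f -> polyfun n e g -> polyfun n (d + e) (fun t S => f t S * g t S).
Proof.
move=> Hf Hg; elim: Hf =>
  {d f} [r|d f f' _ IH _ IH'|d c f _ IH|d f _ IH|d d' f le_d _ IH|d f f' eqf _ IH].
- elim: Hg => {e g} [r'|e f f' _ IH _ IH'|e c f _ IH|e f _ IH|e e' f le_e _ IH|e f f' eqf _ IH].
  + rewrite -big_split /=; apply: (PolyfunExt _ (PolyfunMonomial n (fun i => r i + r' i)%N)) => t S.
    by rewrite -big_split; apply: eq_bigr => i _; rewrite exprD.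
  + by apply: (PolyfunExt _ (PolyfunAdd IH IH')) => t S; rewrite mulrDr.
  + by apply: (PolyfunExt _ (PolyfunScale c IH)) => t S; rewrite mulrCA.
  + by rewrite addnS; apply: (PolyfunExt _ (PolyfunVar IH)) => t S; rewrite mulrCA.
  + by apply: (PolyfunLe _ IH); rewrite leq_add2l.
  + by apply: (PolyfunExt _ IH) => t S; rewrite eqf.
- by apply: (PolyfunExt _ (PolyfunAdd IH IH')) => t S; rewrite mulrDl.
- by apply: (PolyfunExt _ (PolyfunScale c IH)) => t S; rewrite mulrA.
- by rewrite addSn; apply: (PolyfunExt _ (PolyfunVar IH)) => t S; rewrite mulrA.
- by apply: (PolyfunLe _ IH); rewrite leq_add2r.
- by apply: (PolyfunExt _ IH) => t S; rewrite eqf.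
Qed.

Lemma polyfunX n d f k :
  polyfun n d f -> polyfun n (k * d) (fun t S => f t S ^+ k).
Proof.
move=> Hf; elim: k => [|k IH]; first by apply: (PolyfunExt _ (polyfun_cst n 1)).
by rewrite mulSn; apply: (PolyfunExt _ (polyfunM Hf IH)) => t S; rewrite exprS.
Qed.

Lemma polyfun_sum n d k (f : 'I_k -> rat -> (nat -> rat) -> rat) :
  (forall i, polyfun n d (f i)) -> polyfun n d (fun t S => \sum_(i < k) f i t S).
Proof.
elim: k f => [|k IH] f Hf.
  apply: (PolyfunLe (leq0n d)); apply: (PolyfunExt _ (polyfun_cst n 0)) => t S.
  by rewrite big_ord0.
apply: (PolyfunExt _ (PolyfunAdd (IH (fun i => f (widen_ord (leqnSn k) i)) _) (Hf ord_max))) => //.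
by move=> t S; rewrite big_ord_recr.
Qed.

(** Since t is evaluated at the argument of [p], a factor t becomes a factor X. Every closure rule
    thus keeps the shape found for monomials, with one [p] for both values of [b]. *)
Lemma sum_polyfun_words n d f : polyfun n d f ->
  exists2 p : {poly rat}, (size p <= d.+1)%N &
  forall b m, \sum_(w <- words n m) f (node b n m) (profile b w) =
    p.[node b n m] * 'C(n + m, n)%:R.
Proof.
elim=> {d f} [r|d f g _ [p sp Hp] _ [q sq Hq]|d c f _ [p sp Hp]|d f _ [p sp Hp]
  |d e f le_de _ [p sp Hp]|d f g eqfg _ [p sp Hp]].
- exact: sum_monomial_words.
- exists (p + q); first by rewrite (leq_trans (size_polyD _ _)) // geq_max sp.
  by move=> b m; rewrite big_split Hp Hq hornerD mulrDl.
- exists (c *: p); first by rewrite (leq_trans (size_scale_leq _ _)).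
  by move=> b m; rewrite -mulr_sumr Hp hornerZ mulrA.
- exists ('X * p).
    by rewrite (leq_trans (size_polyMleq _ _)) // size_polyX.
  by move=> b m; rewrite -mulr_sumr Hp hornerM hornerX mulrA.
- by exists p => //; rewrite (leq_trans sp).
- by exists p => // b m; rewrite -Hp; apply: eq_bigr => w _; rewrite eqfg.
Qed.

(** * The deviation of a word *)

(** Heights are taken where steps start, so a word returning to its initial height counts each
    vertex of its cycle once. *)
Fixpoint vertex_sum (x y : rat) (k : nat) (h : rat) (w : seq bool) : rat :=
  if w is b :: w' then
    h ^+ k + vertex_sum x y k (if b then h + x else h - y) w'
  else 0.

Fixpoint up_sum (x y : rat) (k : nat) (h : rat) (w : seq bool) : rat :=
  match w with
  | [::] => 0
  | true :: w' => h ^+ k + up_sum x y k (h + x) w'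
  | false :: w' => up_sum x y k (h - y) w'
  end.

Definition height (x y : rat) (w : seq bool) : rat :=
  x * (count id w)%:R - y * (count negb w)%:R.

Lemma height_cons x y b w :
  height x y (b :: w) = (if b then x else - y) + height x y w.
Proof. by rewrite /height /= !natrD; case: b => /=; ring. Qed.

(* Obtained by telescoping the squares, resp. the cubes, of the heights. *)
Lemma vertex_up_sum1 x y h w :
  (h + height x y w) ^+ 2 - h ^+ 2 =
  2 * (x + y) * up_sum x y 1 h w - 2 * y * vertex_sum x y 1 h w
  + x ^+ 2 * (count id w)%:R + y ^+ 2 * (count negb w)%:R.
Proof.
elim: w h => [|b w IH] h; first by rewrite /height /=; ring.
rewrite height_cons.
by case: b => /=; rewrite !natrD addrA; have := IH (h + x); have := IH (h - y); lra.
Qed.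

Lemma vertex_up_sum2 x y h w :
  (h + height x y w) ^+ 3 - h ^+ 3 =
  3 * (x + y) * up_sum x y 2 h w - 3 * y * vertex_sum x y 2 h w
  + 3 * (x ^+ 2 - y ^+ 2) * up_sum x y 1 h w + 3 * y ^+ 2 * vertex_sum x y 1 h w
  + x ^+ 3 * (count id w)%:R - y ^+ 3 * (count negb w)%:R.
Proof.
elim: w h => [|b w IH] h; first by rewrite /height /=; ring.
rewrite height_cons.
by case: b => /=; rewrite !natrD addrA; have := IH (h + x); have := IH (h - y); lra.
Qed.

Lemma up_sum_falses_before x y k h d w :
  up_sum x y k h w =
  \sum_(i < count id w) (h + y * d%:R + x * i%:R - y * (nth 0%N (falses_before d w) i)%:R) ^+ k.
Proof.
elim: w h d => [|[] w IH] h d /=; first by rewrite big_ord0.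
  rewrite big_ord_recl /= mulr0 addr0 addrK (IH _ d); congr (_ + _).
  by apply: eq_bigr => i _; rewrite /bump /= -natr1; congr (_ ^+ k); ring.
rewrite (IH _ d.+1); apply: eq_bigr => i _; rewrite -natr1; congr (_ ^+ k); ring.
Qed.

Lemma vertex_sum_neg x y k h w :
  vertex_sum y x k (- h) (map negb w) = (-1) ^+ k * vertex_sum x y k h w.
Proof.
elim: w h => [|b w IH] h /=; first by rewrite mulr0.
rewrite mulrDr -exprMn mulN1r -IH; congr (_ + vertex_sum _ _ _ _ _).
by case: b => /=; ring.
Qed.

Lemma vertex_sum1_shift x y h w :
  vertex_sum x y 1 h w = vertex_sum x y 1 0 w + h * (size w)%:R.
Proof.
elim: w h => [|b w IH] h /=; first by ring.
by rewrite IH [in RHS]IH -natr1; case: b; ring.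
Qed.

Lemma vertex_sum2_shift x y h w :
  vertex_sum x y 2 h w =
  vertex_sum x y 2 0 w + 2 * h * vertex_sum x y 1 0 w + h ^+ 2 * (size w)%:R.
Proof.
elim: w h => [|b w IH] h /=; first by ring.
rewrite -natr1; case: b; rewrite [in LHS]IH [in RHS]IH.
  by rewrite (vertex_sum1_shift _ _ (0 + x)); ring.
by rewrite (vertex_sum1_shift _ _ (0 - y)); ring.
Qed.

Lemma vertex_sum_rcons x y k h w b :
  vertex_sum x y k h (rcons w b) = vertex_sum x y k h w + (h + height x y w) ^+ k.
Proof.
elim: w h => [|c w IH] h; first by rewrite /height /= !mulr0 subrr !addr0 add0r.
rewrite /= IH height_cons -addrA; congr (_ + (_ + _ ^+ k)).
by case: c; ring.
Qed.

(* On the word of an (s,t)-core this is the size minus its mean. *)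
Definition deviation (s t : nat) (w : seq bool) : rat :=
  ((s + t)%:R * vertex_sum t%:R s%:R 2 0 w - vertex_sum t%:R s%:R 1 0 w ^+ 2)
    / (2 * (s + t)%:R ^+ 2) - s%:R * t%:R * (s + t).+1%:R / 24.

(** Rotating a closed path translates all its heights by one constant, which a variance does not
    see. *)
Lemma deviation_rot s t w : w \in words s t -> deviation s t (rot 1 w) = deviation s t w.
Proof.
case: w => [//|b w] wst; rewrite rot1_cons /deviation.
have sw := size_in_words wst; rewrite /= in sw.
(* The whole word ends at height 0, so [w] undoes the step [b]. *)
have hw : height t%:R s%:R w = - (if b then t%:R else - s%:R).
  apply/eqP; rewrite -addr_eq0 addrC -height_cons /height.
  by move: wst; rewrite mem_words => /andP [/eqP -> /eqP ->]; rewrite mulrC subrr.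
rewrite !vertex_sum_rcons !add0r hw /= -sw.
rewrite (vertex_sum1_shift _ _ (if _ then _ else _)).
rewrite (vertex_sum2_shift _ _ (if _ then _ else _)).
by congr (_ / _ - _); rewrite -natr1; case: b {wst hw}; ring.
Qed.

(** Exchanging the letters negates every height and so preserves the variance. *)
Lemma deviation_neg s t w : deviation t s (map negb w) = deviation s t w.
Proof.
rewrite /deviation addnC -oppr0 !vertex_sum_neg oppr0.
by congr (_ / _ - _ / _); ring.
Qed.

(** As the height returns to 0, the telescoped squares and cubes relate the vertex sums to the
    up-step sums. Half the variance over all s+t vertices becomes half the variance over the s
    up-step vertices, up to a constant. *)
Lemma deviation_up s t w : (0 < s)%N -> w \in words s t ->
  deviation s t w =
  (s%:R * up_sum t%:R s%:R 2 0 w - up_sum t%:R s%:R 1 0 w ^+ 2) / (2 * s%:R ^+ 2)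
  - (s%:R - 1) * t%:R * (s + t)%:R / 24.
Proof.
rewrite /deviation mem_words => s_gt0 /andP [/eqP ws /eqP wt].
have h0 : height t%:R s%:R w = 0 by rewrite /height ws wt mulrC subrr.
have E1 := vertex_up_sum1 t%:R s%:R 0 w; have E2 := vertex_up_sum2 t%:R s%:R 0 w.
rewrite h0 ws wt in E1 E2.
have s0 : s%:R != 0 :> rat by rewrite pnatr_eq0 -lt0n.
have N0 : s%:R + t%:R != 0 :> rat by rewrite -natrD pnatr_eq0 addn_eq0 negb_and -lt0n s_gt0.
rewrite -natr1 natrD.
set A1 := vertex_sum _ _ 1 _ _ in E1 E2 *; set A2 := vertex_sum _ _ 2 _ _ in E1 E2 *.
set U1 := up_sum _ _ 1 _ _ in E1 E2 *; set U2 := up_sum _ _ 2 _ _ in E1 E2 *.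
have -> : U1 = s%:R * A1 / (s%:R + t%:R) - s%:R * t%:R / 2.
  apply: (@mulfI _ (2 * (t%:R + s%:R))); first by rewrite mulf_neq0 // addrC.
  transitivity (2 * s%:R * A1 - t%:R ^+ 2 * s%:R - s%:R ^+ 2 * t%:R); first by lra.
  by field.
have {E2} -> : U2 = s%:R * A2 / (s%:R + t%:R) + (s%:R - t%:R) * U1
   - s%:R ^+ 2 * A1 / (s%:R + t%:R) + s%:R * t%:R * (s%:R - t%:R) / 3.
  apply: (@mulfI _ (3 * (t%:R + s%:R))); first by rewrite mulf_neq0 // addrC.
  transitivity (3 * s%:R * A2 - 3 * (t%:R ^+ 2 - s%:R ^+ 2) * U1 - 3 * s%:R ^+ 2 * A1
     - t%:R ^+ 3 * s%:R + s%:R ^+ 3 * t%:R); first by lra.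
  by field.
(* The expression for [U2] has brought [U1] back. *)
have -> : U1 = s%:R * A1 / (s%:R + t%:R) - s%:R * t%:R / 2.
  apply: (@mulfI _ (2 * (t%:R + s%:R))); first by rewrite mulf_neq0 // addrC.
  transitivity (2 * s%:R * A1 - t%:R ^+ 2 * s%:R - s%:R ^+ 2 * t%:R); first by lra.
  by field.
by field; rewrite s0 N0.
Qed.

(** * Moments of the deviation over all words *)

Definition deviation_moment (k s t : nat) : rat :=
  (\sum_(w <- words s t) deviation s t w ^+ k) / 'C(s + t, s)%:R.

Lemma deviation_moment_sym k s t : deviation_moment k s t = deviation_moment k t s.
Proof.
rewrite /deviation_moment -(perm_big _ (perm_words_neg s t)) /= big_map.
rewrite addnC -[in RHS]bin_sub ?leq_addr // addKn; congr (_ / _).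
by apply: eq_bigr => w _; rewrite deviation_neg.
Qed.

Lemma big_words_head (F : seq bool -> rat) n t :
  \sum_(w <- words n.+1 t | head false w) F w = \sum_(w <- words n t) F (true :: w).
Proof.
rewrite -big_filter -(big_map (cons true) predT F); apply: perm_big.
have inj : injective (cons true) by move=> w1 w2 [].
apply: uniq_perm; rewrite ?filter_uniq ?map_inj_uniq ?uniq_words // => w.
rewrite mem_filter mem_words; case: w => [|[] w] /=.
- by apply/esym/negbTE/mapP => -[].
- by rewrite (mem_map inj) mem_words.
- by apply/esym/negbTE/mapP => -[].
Qed.

(** Of the rotations of a word, n+1 begin with an up step, and all have the same deviation; so
    requiring an initial up step does not change the average. The other n up steps are the
    coordinates of the profile. *)
Lemma deviation_moment_head k n t :
  \sum_(w <- words n t) deviation n.+1 t (true :: w) ^+ k =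
  deviation_moment k n.+1 t * 'C(n + t, n)%:R.
Proof.
have H (f : seq bool -> rat) : {in words n.+1 t, forall w, f (rot 1 w) = f w} ->
    (n.+1 + t)%:R * \sum_(w <- words n t) f (true :: w)
    = n.+1%:R * \sum_(w <- words n.+1 t) f w.
  move=> frot; rewrite -big_words_head; apply: sum_rotations => // w ww.
  rewrite -(size_in_words ww); move: ww; rewrite mem_words => /andP [/eqP <- _].
  rewrite -[RHS]count_head_rot; apply: eq_bigr => i _.
  by case: (rot i w).
have N0 : (n.+1 + t)%:R != 0 :> rat by rewrite pnatr_eq0.
have C0 : 'C(n.+1 + t, n.+1)%:R != 0 :> rat by rewrite pnatr_eq0 -lt0n bin_gt0 leq_addr.
apply: (mulfI N0); rewrite (H (fun w => deviation n.+1 t w ^+ k)) => [|w ww].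
  2: by rewrite deviation_rot.
have E : (n.+1 + t)%:R * 'C(n + t, n)%:R = n.+1%:R * 'C(n.+1 + t, n.+1)%:R :> rat.
  by rewrite -!natrM -mul_bin_diag.
rewrite mulrCA E /deviation_moment.
by rewrite mulrCA mulfVK.
Qed.

(** The formula of [deviation_up] for [true :: w], extended to arbitrary rational arguments so that
    it also makes sense at negative t. [T i] is the height at which up step i of [w] starts; the
    initial up step starts at 0 and adds nothing. *)
Definition deviation_profile (n : nat) (t : rat) (S : nat -> rat) : rat :=
  let T i := t * i.+1%:R - n.+1%:R * S i in
  (n.+1%:R * (\sum_(i < n) T i ^+ 2) - (\sum_(i < n) T i) ^+ 2) / (2 * n.+1%:R ^+ 2)
  - n%:R * t * (n.+1%:R + t) / 24.

Lemma deviation_profileE n t w : w \in words n t ->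
  deviation n.+1 t (true :: w) = deviation_profile n t%:R (profile false w).
Proof.
move=> ww; rewrite deviation_up //; last by move: ww; rewrite !mem_words.
rewrite /deviation_profile natrD.
have -> : n.+1%:R - 1 = n%:R :> rat by rewrite -natr1 addrK.
have E k : up_sum t%:R n.+1%:R k.+1 0 (true :: w) =
    \sum_(i < n) (t%:R * i.+1%:R - n.+1%:R * profile false w i) ^+ k.+1.
  rewrite /= expr0n add0r (up_sum_falses_before _ _ _ _ 0).
  move: ww; rewrite mem_words => /andP [/eqP -> _]; apply: eq_bigr => i _.
  by congr (_ ^+ k.+1); rewrite /profile /node /= -natr1; ring.
by rewrite !E.
Qed.

(** Replacing t by -(n+1)-t and S i by -(i+1)-S i negates every [T i] and fixes t(n+1+t). *)
Lemma deviation_profile_dual n m w :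
  deviation_profile n (node true n m) (profile true w) =
  deviation_profile n (node false n m) (profile false w).
Proof.
rewrite /deviation_profile /profile /node.
have E i : (- n.+1%:R - m%:R) * i.+1%:R - n.+1%:R * (- i.+1%:R - (nth 0%N (falses_before 0 w) i)%:R)
   = - (m%:R * i.+1%:R - n.+1%:R * (nth 0%N (falses_before 0 w) i)%:R) :> rat by ring.
under eq_bigr => i _ do rewrite E sqrrN.
under [X in X ^+ 2]eq_bigr => i _ do rewrite E.
by rewrite sumrN sqrrN; congr (_ - _ / _); ring.
Qed.

Lemma polyfun_deviation_profile n : polyfun n 2 (deviation_profile n).
Proof.
have PT (i : 'I_n) : polyfun n 1 (fun t S => t * i.+1%:R - n.+1%:R * S i).
  apply: PolyfunExt (PolyfunAdd (PolyfunScale i.+1%:R (polyfun_var n))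
    (PolyfunScale (- n.+1%:R) (polyfun_coord i))) => t S.
  by rewrite mulrC mulNr.
have P2 := polyfun_sum (fun i => polyfunX 2 (PT i)).
have P1 := polyfunX 2 (polyfun_sum PT).
have Pt := polyfunM (polyfun_var n)
  (PolyfunAdd (PolyfunLe (leq0n 1) (polyfun_cst n n.+1%:R)) (polyfun_var n)).
apply: PolyfunExt (PolyfunAdd (PolyfunAdd
  (PolyfunScale (n.+1%:R / (2 * n.+1%:R ^+ 2)) P2)
  (PolyfunScale (- (2 * n.+1%:R ^+ 2)^-1) P1))
  (PolyfunScale (- (n%:R / 24)) Pt)) => t S.
by rewrite /deviation_profile; ring.
Qed.

(** The deviation has degree 2 in t and the profile, so its k-th power has degree 2k, and the
    binomial cancels. The case [b = true] is the invariance under replacing t by -(n+1)-t. *)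
Lemma deviation_moment_poly k n : exists2 p : {poly rat}, (size p <= (2 * k).+1)%N &
  forall b t, p.[node b n t] = deviation_moment k n.+1 t.
Proof.
have [p sp Hp] := sum_polyfun_words (polyfunX k (polyfun_deviation_profile n)).
exists p; first by rewrite mulnC.
move=> b t; have C0 : 'C(n + t, n)%:R != 0 :> rat by rewrite pnatr_eq0 -lt0n bin_gt0 leq_addr.
apply: (mulIf C0); rewrite -Hp -deviation_moment_head; apply: eq_big_seq => w ww.
by rewrite deviation_profileE //; case: b; rewrite ?deviation_profile_dual.
Qed.

Lemma deviation_moment0 k n : (0 < k)%N -> deviation_moment k n.+1 0 = 0.
Proof.
move=> k_gt0; have := deviation_moment_head k n 0; rewrite addn0 binn mulr1 => <-.
rewrite big1_seq // => w /andP [_ ww]; rewrite deviation_profileE // /deviation_profile.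
have fb : falses_before 0 w = nseq n 0%N.
  move: ww; rewrite mem_words => /andP [/eqP <-].
  by elim: w => [|[] w IH] //= /IH ->.
have T0 (i : 'I_n) : 0%:R * i.+1%:R - n.+1%:R * profile false w i = 0 :> rat.
  by rewrite /profile fb nth_nseq ltn_ord /= mul0r mulr0 subrr.
have -> : \sum_(i < n) (0%:R * i.+1%:R - n.+1%:R * profile false w i) ^+ 2 = 0 :> rat.
  by apply: big1 => i _; rewrite T0 expr0n.
rewrite big1 => [|i _]; last by rewrite T0.
by rewrite !mulr0 (expr0n _ 2) subr0 !mul0r subr0 expr0n gtn_eqF.
Qed.

(** The rows s <= k come first, from the grid and symmetry. In any other row the values at t <= k
    are then known by symmetry, and interpolation fills the row. *)
Lemma deviation_moment_eq k (G : rat -> rat -> rat) :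
    (0 < k)%N ->
    (forall s, exists2 g : {poly rat}, (size g <= (2 * k).+1)%N & forall t, g.[t] = G s t) ->
    (forall s t, G s t = G t s) -> (forall s t, G s (- s - t) = G s t) ->
    (forall s, G s 0 = 0) ->
    (forall s t, (0 < s <= t)%N -> (t <= k)%N -> deviation_moment k s t = G s%:R t%:R) ->
  forall s t, (0 < s)%N -> deviation_moment k s t = G s%:R t%:R.
Proof.
move=> k_gt0 Gpoly Gsym Grec G0 grid.
have extend s : (0 < s)%N ->
    (forall t, (0 < t <= k)%N -> deviation_moment k s t = G s%:R t%:R) ->
    forall t, deviation_moment k s t = G s%:R t%:R.
  case: s => // n _ small t.
  have [p sp Hp] := deviation_moment_poly k n; have [g sg Hg] := Gpoly n.+1%:R.
  have Hg' b m : g.[node b n m] = G n.+1%:R m%:R by rewrite Hg; case: b; rewrite //= Grec.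
  suff : p - g = 0 by move/subr0_eq => E; rewrite -(Hp false) E Hg'.
  (* The points m and -(n+1)-m for 0 <= m <= k are 2k+2 distinct roots, the former nonnegative and
     the latter negative, while [p - g] has degree at most 2k. *)
  pose rs := [seq node false n m | m <- iota 0 k.+1] ++ [seq node true n m | m <- iota 0 k.+1].
  apply: (@roots_geq_poly_eq0 _ _ rs).
  - apply/allP => x; rewrite mem_cat => /orP[] /mapP [m]; rewrite mem_iota add0n ltnS => mk ->;
    rewrite /root hornerD hornerN Hp Hg' subr_eq0; case: m mk => [|m] mk;
    by rewrite ?deviation_moment0 ?G0 ?small.
  - rewrite cat_uniq; apply/and3P; split.
    + by rewrite map_inj_uniq ?iota_uniq // => m m' /eqP; rewrite eqr_nat => /eqP.
    + apply/hasPn => x /mapP [m _ ->]; apply/mapP => -[m' _ /eqP].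
      by rewrite /node -subr_eq0 -opprD -opprD oppr_eq0 -!natrD pnatr_eq0.
    + rewrite map_inj_uniq ?iota_uniq // => m m' /addrI /oppr_inj /eqP.
      by rewrite eqr_nat => /eqP.
  - rewrite size_cat !size_map size_iota (leq_trans (size_polyD _ _)) // size_polyN geq_max.
    by rewrite (leq_trans sp) ?(leq_trans sg) //; lia.
have small s : (0 < s <= k)%N -> forall t, deviation_moment k s t = G s%:R t%:R.
  move=> /andP [s_gt0 le_sk]; apply: extend => // t /andP [t_gt0 le_tk].
  have [le_st|/ltnW le_ts] := leqP s t; first by rewrite grid ?s_gt0.
  by rewrite deviation_moment_sym Gsym grid ?t_gt0.
move=> s t s_gt0; apply: extend => // t' t'P.
by rewrite deviation_moment_sym Gsym small.
Qed.

(** * The first and the seventh moment *)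

Lemma deviation_moment1l k t : (0 < k)%N -> deviation_moment k 1 t = 0.
Proof.
move=> k_gt0; have := deviation_moment_head k 0 t; rewrite bin0 mulr1 => <-.
rewrite big1_seq // => w /andP [_ ww]; rewrite deviation_profileE // /deviation_profile.
by rewrite !big_ord0 !mulr0 (expr0n _ 2) subr0 !mul0r subr0 expr0n gtn_eqF.
Qed.

(** For k = 1 the grid is the single pair s = t = 1. Hence the constant subtracted in [deviation] is
    the mean of the half variance. *)
Lemma deviation_moment1_eq0 s t : (0 < s)%N -> deviation_moment 1 s t = 0.
Proof.
apply: (@deviation_moment_eq 1 (fun _ _ => 0)) => // [_|s' t' /andP [s_gt0 le_st] le_t1].
  by exists 0; rewrite ?size_poly0 // => t'; rewrite horner0.
have -> : s' = 1%N by lia.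
by rewrite deviation_moment1l.
Qed.

(** * Exact computation with binary integers *)

Definition ratZ (z : Z) : rat := (int_of_Z z)%:~R.

Lemma ratZD x y : ratZ (x + y)%stdZ = ratZ x + ratZ y.
Proof. by rewrite /ratZ (rmorphD int_of_Z) rmorphD. Qed.

Lemma ratZB x y : ratZ (x - y)%stdZ = ratZ x - ratZ y.
Proof. by rewrite /ratZ (rmorphB int_of_Z) rmorphB. Qed.

Lemma ratZM x y : ratZ (x * y)%stdZ = ratZ x * ratZ y.
Proof. by rewrite /ratZ (rmorphM int_of_Z) rmorphM. Qed.

Lemma ratZ_nat n : ratZ (Z.of_nat n) = n%:R.
Proof. by case: n => // n; rewrite /ratZ /= SuccNat2Pos.id_succ. Qed.

Lemma ratZ_neq0 z : ~~ Z.eqb z 0 -> ratZ z != 0.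
Proof.
move=> /negbTE/Z.eqb_neq z0; rewrite /ratZ intr_eq0; apply/eqP => E; apply: z0.
by apply: (can_inj int_of_ZK); rewrite E.
Qed.

Definition powZ (x : Z) (k : nat) : Z := iter k (Z.mul x) 1%stdZ.

Lemma ratZX x k : ratZ (powZ x k) = ratZ x ^+ k.
Proof. by elim: k => [//|k IH]; rewrite exprS -IH -ratZM. Qed.

Lemma ratZ_foldr (T : Type) (f : T -> Z) (l : seq T) :
  ratZ (foldr (fun x acc => f x + acc)%stdZ Z0 l) = \sum_(x <- l) ratZ (f x).
Proof. by elim: l => [|x l IH]; rewrite ?big_nil // big_cons -IH -ratZD. Qed.

(* Coefficients of the seventh central moment of the size of an (s,t)-core,
   times 1195587993600, as a polynomial in a = s^2 + s t + t^2 and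
   b = s t (s + t): the entry (c, i, j) stands for c a^i b^j. They were found by
   interpolation at the points 1 <= s <= t <= 7. *)
Definition moment7_coefs : seq (Z * nat * nat) :=
  ([::
   ((-1379125440)%stdZ, 0, 1); ((-1477481040)%stdZ, 0, 2);
   ((-98801043)%stdZ, 0, 3); (369909%stdZ, 0, 4); (574669%stdZ, 0, 5);
   ((-225121)%stdZ, 0, 6); (15562%stdZ, 0, 7); (1651104000%stdZ, 1, 1);
   (369418140%stdZ, 1, 2); ((-2749614)%stdZ, 1, 3); ((-1684005)%stdZ, 1, 4);
   (1508536%stdZ, 1, 5); ((-158093)%stdZ, 1, 6); ((-272432160)%stdZ, 2, 1);
   (2201400%stdZ, 2, 2); (1082532%stdZ, 2, 3); ((-3802077)%stdZ, 2, 4);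
   (686323%stdZ, 2, 5); (176400%stdZ, 3, 2); (4230414%stdZ, 3, 3);
   ((-1617843)%stdZ, 3, 4); ((-1731240)%stdZ, 4, 2); (2165391%stdZ, 4, 3);
   ((-1544940)%stdZ, 5, 2); (453600%stdZ, 6, 1)])%N.

Definition moment7_ab (a b : rat) : rat :=
  (\sum_(c <- moment7_coefs) ratZ c.1.1 * a ^+ c.1.2 * b ^+ c.2)
  / ratZ 1195587993600%stdZ.

Definition moment7 (s t : rat) : rat :=
  moment7_ab (s ^+ 2 + s * t + t ^+ 2) (s * t * (s + t)).

Definition moment7Z (s t : Z) : Z :=
  let a := (s * s + s * t + t * t)%stdZ in let b := (s * t * (s + t))%stdZ in
  foldr (fun c acc => (c.1.1 * powZ a c.1.2 * powZ b c.2 + acc)%stdZ) 0%stdZ moment7_coefs.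

Lemma moment7ZE s t : ratZ (moment7Z s t) = moment7 (ratZ s) (ratZ t) * ratZ 1195587993600%stdZ.
Proof.
rewrite /moment7 /moment7_ab (mulfVK (@ratZ_neq0 1195587993600%stdZ isT)) /moment7Z.
rewrite ratZ_foldr; apply: eq_bigr => c _.
by rewrite !ratZM !ratZX !ratZD !ratZM ratZD.
Qed.

(** In t both a and b have degree at most 2, and i + j <= 7 throughout the table, so the degree is
    at most 14. *)
Lemma moment7_poly s :
  exists2 g : {poly rat}, (size g <= 15)%N & forall t, g.[t] = moment7 s t.
Proof.
pose A : {poly rat} := (s ^+ 2)%:P + s *: 'X + 'X ^+ 2.
pose B : {poly rat} := s *: 'X * (s%:P + 'X).
exists ((ratZ 1195587993600%stdZ)^-1 *:
  \sum_(c <- moment7_coefs) ratZ c.1.1 *: (A ^+ c.1.2 * B ^+ c.2)).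
  rewrite (leq_trans (size_scale_leq _ _)) //.
  have sA : (size A <= 3)%N.
    rewrite (leq_trans (size_polyD _ _)) // geq_max size_polyXn andbT.
    rewrite (leq_trans (size_polyD _ _)) // geq_max (leq_trans (size_polyC_leq1 _)) //.
    by rewrite (leq_trans (size_scale_leq _ _)) // size_polyX.
  have sB : (size B <= 3)%N.
    rewrite (leq_trans (size_polyMleq _ _)) //.
    have h1 : (size (s *: 'X : {poly rat})%R <= 2)%N.
      by rewrite (leq_trans (size_scale_leq _ _)) // size_polyX.
    have h2 : (size (s%:P + 'X : {poly rat})%R <= 2)%N.
      by rewrite (leq_trans (size_polyD _ _)) // geq_max size_polyX (leq_trans (size_polyC_leq1 _)).
    lia.
  have sX (P : {poly rat}) i : (size P <= 3)%N -> (size (P ^+ i)%R <= (2 * i).+1)%N.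
    move=> sP; rewrite (leq_trans (size_poly_exp_leq _ _)) // ltnS leq_mul2r.
    by case: (size P) sP => [|[|[|[|]]]] //; rewrite ?orbT.
  have : all (fun c => c.1.2 + c.2 <= 7)%N moment7_coefs by [].
  elim: moment7_coefs => [|c l IH] /=; first by rewrite big_nil size_poly0.
  move=> /andP [hc hl]; rewrite big_cons (leq_trans (size_polyD _ _)) // geq_max IH // andbT.
  rewrite (leq_trans (size_scale_leq _ _)) // (leq_trans (size_polyMleq _ _)) //.
  rewrite -subn1 leq_subLR (leq_trans (leq_add (sX A _ sA) (sX B _ sB))) //; lia.
move=> t; rewrite hornerZ horner_sum mulrC /moment7 /moment7_ab; congr (_ / _).
apply: eq_bigr => c _; rewrite hornerZ hornerM !horner_exp mulrA.
by congr (_ * _ ^+ _ * _ ^+ _); rewrite !hornerE.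
Qed.

Fixpoint up_sumsZ (x y h u1 u2 : Z) (w : seq bool) : Z * Z :=
  match w with
  | [::] => (u1, u2)
  | true :: w' => up_sumsZ x y (h + x) (u1 + h) (u2 + h * h) w'
  | false :: w' => up_sumsZ x y (h - y) u1 u2 w'
  end%stdZ.

Lemma up_sumsZE x y h u1 u2 w :
  (ratZ (up_sumsZ x y h u1 u2 w).1 = ratZ u1 + up_sum (ratZ x) (ratZ y) 1 (ratZ h) w) *
  (ratZ (up_sumsZ x y h u1 u2 w).2 = ratZ u2 + up_sum (ratZ x) (ratZ y) 2 (ratZ h) w).
Proof.
elim: w h u1 u2 => [|[] w IH] h u1 u2 /=; first by rewrite !addr0.
  by split; rewrite IH !ratZD ?ratZM; ring.
by split; rewrite IH ratZB.
Qed.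

(** The formula of [deviation_up] multiplied by 24 s^2, which clears its denominators. *)
Definition deviationZ (s t : Z) (w : seq bool) : Z :=
  let u := up_sumsZ t s 0 0 0 w in
  (12 * (s * u.2 - u.1 * u.1) - s * s * (s - 1) * t * (s + t))%stdZ.

Lemma deviationZE s t w : (0 < s)%N -> w \in words s t ->
  deviation s t w = ratZ (deviationZ (Z.of_nat s) (Z.of_nat t) w) / (24 * s%:R ^+ 2).
Proof.
move=> s_gt0 ww; rewrite deviation_up // /deviationZ.
rewrite !(ratZB, ratZM, ratZD) !up_sumsZE !ratZ_nat natrD.
rewrite (_ : ratZ Z0 = 0) // (_ : ratZ 1%stdZ = 1) // (_ : ratZ 12%stdZ = 12) //.
by field; rewrite pnatr_eq0 -lt0n.
Qed.

(** Equality of the moments at (n+1, t) with all denominators cleared. By [deviation_moment_head]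
    only words with an initial up step are summed. *)
Definition grid_check (n t : nat) : bool :=
  let s := Z.of_nat n.+1 in let t' := Z.of_nat t in let ws := words n t in
  Z.eqb (1195587993600 *
     foldr (fun w acc => powZ (deviationZ s t' (true :: w)) 7 + acc) 0 ws)%stdZ
   (Z.of_nat (size ws) * powZ (24 * (s * s)) 7 * moment7Z s t')%stdZ.

Lemma grid_checkP n t : grid_check n t ->
  deviation_moment 7 n.+1 t = moment7 n.+1%:R t%:R.
Proof.
have cross_cancel (c d x m y : rat) : c != 0 -> d != 0 -> x != 0 ->
    c * (d * (m * x)) = x * d * (y * c) -> m = y.
  move=> c0 d0 x0 E; apply: (mulfI c0); apply: (mulfI d0); apply: (mulfI x0).
  by transitivity (c * (d * (m * x))); [ring|rewrite E; ring].
have h24 : ratZ 24%stdZ = 24 by [].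
have e0 : 24 * n.+1%:R ^+ 2 != 0 :> rat.
  by apply: mulf_neq0; [rewrite pnatr_eq0|apply: expf_neq0; rewrite pnatr_eq0].
have := @ratZ_neq0 1195587993600%stdZ isT.
move=> c0 /Z.eqb_eq /(congr1 ratZ); rewrite !(ratZM, ratZX) moment7ZE !ratZ_nat size_words.
move: (ratZ 1195587993600%stdZ) c0 => c c0.
have -> : ratZ (foldr (fun w acc =>
    powZ (deviationZ (Z.of_nat n.+1) (Z.of_nat t) (true :: w)) 7 + acc)%stdZ 0%stdZ (words n t))
  = (24 * n.+1%:R ^+ 2) ^+ 7 * \sum_(w <- words n t) deviation n.+1 t (true :: w) ^+ 7.
  rewrite ratZ_foldr mulr_sumr; apply: eq_big_seq => w ww; rewrite ratZX.
  rewrite (deviationZE (ltn0Sn n)); last by move: ww; rewrite !mem_words.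
  by rewrite -exprMn mulrCA (divff e0) mulr1.
rewrite deviation_moment_head h24 -expr2.
have C0 : 'C(n + t, n)%:R != 0 :> rat by rewrite pnatr_eq0 -lt0n bin_gt0 leq_addr.
exact: (cross_cancel c _ _ _ _ c0 (expf_neq0 7 e0) C0).
Qed.

Lemma grid_check7 :
  all (fun s => all (fun t => (s <= t)%N ==> grid_check s.-1 t) (iota 1 7)) (iota 1 7).
Proof. by vm_compute. Qed.

Lemma deviation_moment7 s t : (0 < s)%N -> deviation_moment 7 s t = moment7 s%:R t%:R.
Proof.
move: s t; apply: (@deviation_moment_eq 7 moment7 isT moment7_poly).
- by move=> s t; rewrite /moment7; congr moment7_ab; ring.
(* Replacing t by -s-t fixes both s^2+st+t^2 and st(s+t). *)
- by move=> s t; rewrite /moment7; congr moment7_ab; ring.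
(* At t = 0 the invariant b vanishes, and every entry of the table has a positive power of b. *)
- move=> s; rewrite /moment7 mulr0 mul0r /moment7_ab; apply/eqP.
  rewrite mulf_eq0; apply/orP; left; apply/eqP; apply: big1_seq => c /andP [_ cl].
  have : all (fun c => 0 < c.2)%N moment7_coefs by [].
  by move=> /allP /(_ _ cl) c_gt0; rewrite (expr0n _ c.2) gtn_eqF // mulr0.
case=> [|n] t /andP [n_gt0 le_nt] le_t7; first by case: (notF n_gt0).
apply: grid_checkP.
have nin : n.+1 \in iota 1 7 by rewrite mem_iota; lia.
have tin : t \in iota 1 7 by rewrite mem_iota; lia.
by have /allP/(_ _ nin)/allP/(_ _ tin) := grid_check7; rewrite le_nt.
Qed.

(** * The cycle lemma and area sequences *)

Definition heightz (s : nat) (w : seq bool) : int :=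
  s.+1%:Z * (count id w)%:Z - s%:Z * (count negb w)%:Z.

Lemma heightz_cat s w1 w2 : heightz s (w1 ++ w2) = heightz s w1 + heightz s w2.
Proof. by rewrite /heightz !count_cat !PoszD; ring. Qed.

Lemma heightz_words s w : w \in words s s.+1 -> heightz s w = 0.
Proof.
by rewrite mem_words /heightz => /andP [/eqP -> /eqP ->]; rewrite mulrC subrr.
Qed.

(* For the steps +(s+1), -s the height after i steps is congruent to i/2
   modulo 2s+1, so the heights along a period are distinct. *)
Lemma heightz_take_inj s w i j : (i <= size w)%N -> (j <= size w)%N ->
  (i < 2 * s + 1)%N -> (j < 2 * s + 1)%N ->
  heightz s (take i w) = heightz s (take j w) -> i = j.
Proof.
move=> iw jw iN jN E.
have H k : (k <= size w)%N -> (k < 2 * s + 1)%N ->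
    ((2 * heightz s (take k w)) %% (2 * s + 1)%N)%Z = k%:Z.
  move=> kw kN; rewrite /heightz.
  have : (count id (take k w) + count negb (take k w) = k)%N.
    by rewrite -[RHS](size_takel kw) -(count_predC id).
  set u := count id _; set d := count negb _ => Ek.
  have -> : 2 * (s.+1%:Z * u%:Z - s%:Z * d%:Z) = (u%:Z - d%:Z) * (2 * s + 1)%N%:Z + k%:Z.
    by rewrite -Ek; nia.
  by rewrite modzMDl modz_small //; lia.
by have := H i iw iN; rewrite E H // => -[].
Qed.

Lemma heightz_take_rot s w i j : heightz s w = 0 -> (i < size w)%N -> (j < size w)%N ->
  heightz s (take j (rot i w)) =
  heightz s (take ((i + j) %% size w)%N w) - heightz s (take i w).
Proof.
move=> w0 iw jw; have dw : heightz s (drop i w) = - heightz s (take i w).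
  by apply/eqP; rewrite -addr_eq0 addrC -heightz_cat cat_take_drop w0.
rewrite /rot take_cat size_drop; case: ltnP => jwi.
  rewrite modn_small; last by lia.
  by rewrite takeD heightz_cat addrC addKr.
have -> : ((i + j) %% size w = j - (size w - i))%N.
  rewrite (_ : i + j = j - (size w - i) + size w)%N; last by lia.
  by rewrite modnDr modn_small //; lia.
by rewrite heightz_cat dw addrC take_takel //; lia.
Qed.

(** Only the starting points of steps are tested; the words in [words s s.+1] end at height 0. *)
Definition dyck (s : nat) (w : seq bool) : bool :=
  all (fun i => 0 <= heightz s (take i w)) (iota 0 (size w)).

(** Rotating to vertex i subtracts its height from all heights, so the result is Dyck exactly when
    vertex i is lowest. *)
Lemma dyck_rot s w i : w \in words s s.+1 -> (i < size w)%N ->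
  dyck s (rot i w) = all (fun j => heightz s (take i w) <= heightz s (take j w)) (iota 0 (size w)).
Proof.
move=> ww iw; have w0 := heightz_words ww.
rewrite /dyck size_rot; apply/allP/allP => H j; rewrite mem_iota add0n => jw.
- have := H ((j + (size w - i)) %% size w)%N; rewrite mem_iota add0n.
  have r_lt : ((j + (size w - i)) %% size w < size w)%N by rewrite ltn_mod; lia.
  rewrite r_lt => /(_ isT); rewrite heightz_take_rot // subr_ge0 modnDmr.
  by rewrite (_ : i + _ = j + size w)%N ?modnDr ?modn_small //; lia.
- rewrite heightz_take_rot // subr_ge0; apply: H.
  by rewrite mem_iota add0n ltn_mod; lia.
Qed.

(** The heights along one period are distinct, so the minimum is attained at exactly one vertex. *)
Lemma cycle_lemma s w : w \in words s s.+1 ->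
  (\sum_(i < s + s.+1) (dyck s (rot i w) : nat) = 1)%N.
Proof.
move=> ww; have sw := size_in_words ww; have w0 := heightz_words ww.
have N0 : (0 < s + s.+1)%N by lia.
pose i0 : 'I_(s + s.+1) := Ordinal N0.
have [m _ m_min] := @Order.TotalTheory.arg_minP _ _ _ i0 xpredT
  (fun i : 'I_(s + s.+1) => heightz s (take i w)) isT.
rewrite (bigD1 m) //= dyck_rot ?sw // big1 => [|i ne_im].
  rewrite (_ : all _ _) //; apply/allP => j; rewrite mem_iota add0n => jN.
  exact: (m_min (Ordinal jN)).
rewrite dyck_rot ?sw //; case: allP => // H.
case/eqP: ne_im; apply: val_inj => /=.
apply: (@heightz_take_inj s w); rewrite ?sw ?(ltnW (ltn_ord _)) //; try by lia.
  by have := ltn_ord i; lia.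
  by have := ltn_ord m; lia.
apply/eqP; rewrite eq_le m_min // andbT; apply: H.
by rewrite mem_iota add0n ltn_ord.
Qed.

Lemma falses_before_cat d w1 w2 :
  falses_before d (w1 ++ w2) = falses_before d w1 ++ falses_before (d + count negb w1) w2.
Proof.
elim: w1 d => [|[] w1 IH] d /=; first by rewrite addn0.
  by rewrite IH add0n.
by rewrite IH add1n addSnnS.
Qed.

Lemma falses_before_ge d w : all (leq d) (falses_before d w).
Proof.
elim: w d => [|[] w IH] d //=; first by rewrite leqnn IH.
by apply: sub_all (IH d.+1) => x; apply: ltnW.
Qed.

Lemma falses_before_inj d w1 w2 : count negb w1 = count negb w2 ->
  falses_before d w1 = falses_before d w2 -> w1 = w2.
Proof.
elim: w1 w2 d => [|[] w1 IH] [|[] w2] d //=.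
- by move=> [] E [] /IH ->.
- move=> _ E; have := falses_before_ge d.+1 w2.
  by rewrite -E /= ltnn.
- move=> _ E; have := falses_before_ge d.+1 w1.
  by rewrite E /= ltnn.
- by move=> [] E /IH ->.
Qed.

Lemma falses_before_sorted d w : sorted leq (falses_before d w).
Proof.
elim: w d => [|[] w IH] d //=; rewrite path_sortedE; last exact: leq_trans.
by rewrite falses_before_ge IH.
Qed.

Lemma falses_before_onto d t l : path leq d l -> all (leq^~ t) l -> (d <= t)%N ->
  exists2 w, falses_before d w = l & (d + count negb w = t)%N.
Proof.
have fb_nseq n e : falses_before e (nseq n false) = [::] by elim: n e => //=.
elim: l d => [|a l IH] d /=.
  move=> _ _ le_dt; exists (nseq (t - d) false); last by rewrite count_nseq mul1n subnKC.
  exact: fb_nseq.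
move=> /andP [le_da pl] /andP [le_at al] _.
have [w wl wt] := IH a pl al le_at.
exists (nseq (a - d) false ++ true :: w).
  by rewrite falses_before_cat fb_nseq count_nseq mul1n subnKC //= wl.
by rewrite count_cat count_nseq /= mul1n add0n addnA subnKC.
Qed.

Lemma falses_before_split d w j : (j < count id w)%N ->
  exists w1 w2, [/\ w = w1 ++ true :: w2, count id w1 = j &
    nth 0%N (falses_before d w) j = d + count negb w1]%N.
Proof.
elim: w d j => [|[] w IH] d j //=.
  case: j => [_|j]; first by exists [::], w; rewrite addn0.
  rewrite add1n ltnS => /(IH d) [w1 [w2 [-> <- H]]].
  by exists (true :: w1), w2; rewrite /= add1n add0n.
rewrite add0n => /(IH d.+1) [w1 [w2 [-> <- H]]].
by exists (false :: w1), w2; rewrite /= add0n add1n addnS -addSn.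
Qed.

(** With d down steps before it, up step j starts at height s(j-d)+j, and j < s makes this
    nonnegative exactly when d <= j. Any earlier vertex since the previous up step is at least as
    high. *)
Lemma dyck_falses_before s w : w \in words s s.+1 ->
  dyck s w <-> forall j, (j < s)%N -> (nth 0 (falses_before 0 w) j <= j)%N.
Proof.
rewrite mem_words => /andP [/eqP ws /eqP wt]; split=> [/allP H j js|H].
- have [|w1 [w2 [E Ej ->]]] := @falses_before_split 0 w j; first by rewrite ws.
  have := H (size w1); rewrite E mem_iota add0n size_cat /= take_size_cat // /heightz Ej.
  by move=> /(_ ltac:(lia)); nia.
- apply/allP => i _; rewrite /heightz.
  have := ws; have := wt; rewrite -{1 2}(cat_take_drop i w) !count_cat.
  set u := count id (take i w); set d := count negb (take i w) => Ed Eu.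
  (* If all s up steps are used, the path only descends to its end at height 0. *)
  have [us|us] := ltnP u s; last by nia.
  have : (d <= nth 0 (falses_before 0 w) u)%N.
    rewrite -{1}(cat_take_drop i w) falses_before_cat nth_cat size_falses_before ltnn subnn add0n.
    have := falses_before_ge d (drop i w); have := size_falses_before d (drop i w).
    case: (falses_before d (drop i w)) => [E0 _|a l _ /=].
      by exfalso; move: Eu us; rewrite -E0 addn0 => ->; rewrite ltnn.
    by move=> /andP [].
  by have := H u us; nia.
Qed.

(** * Beta sets *)

(** The beta numbers, that is, the hook lengths of the first column. *)
Fixpoint beta_set (la : seq nat) : seq nat :=
  if la is a :: l then (a + size l)%N :: beta_set l else [::].

Fixpoint unbeta (B : seq nat) : seq nat :=
  if B is b :: l then (b - size l)%N :: unbeta l else [::].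

Lemma size_beta_set la : size (beta_set la) = size la.
Proof. by elim: la => //= a l ->. Qed.

Lemma size_unbeta B : size (unbeta B) = size B.
Proof. by elim: B => //= a l ->. Qed.

Lemma beta_setK : cancel beta_set unbeta.
Proof. by elim=> //= a l ->; rewrite size_beta_set addnK. Qed.

Lemma nth_beta_set la i : (i < size la)%N ->
  nth 0%N (beta_set la) i = (nth 0 la i + (size la - i.+1))%N.
Proof.
elim: la i => [|a l IH] [|i] //= => [_|il]; first by rewrite subSS subn0.
by rewrite IH // subSS.
Qed.

Lemma sumn_beta_set la : sumn (beta_set la) = (sumn la + 'C(size la, 2))%N.
Proof. by elim: la => //= a l ->; rewrite binS bin1; lia. Qed.

Lemma is_partition_cons a l :
  is_partition (a :: l) = [&& (1 <= a)%N, all (geq a) l & is_partition l].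
Proof.
rewrite /is_partition /= path_sortedE; last by move=> x y z; rewrite /geq /=; lia.
by case: (all _ _); case: (sorted _ _); case: (all _ _); case: (0 < a)%N.
Qed.

Lemma beta_set_strict la : is_partition la -> sorted gtn (beta_set la) && all (leq 1) (beta_set la).
Proof.
elim: la => //= a l IH; rewrite is_partition_cons => /and3P [a_gt0 al /IH /andP [sl pl]].
rewrite pl andbT addn_gt0 a_gt0 andbT.
case: l al sl {IH pl} => //= b l /andP [ba _] ->.
rewrite andbT /gtn /=; move: ba; rewrite /geq /=; lia.
Qed.

Lemma unbeta_partition B : sorted gtn B -> all (leq 1) B ->
  is_partition (unbeta B) /\ beta_set (unbeta B) = B.
Proof.
move=> sB pB.
have size_lt b l : path gtn b l -> all (leq 1) l -> (size l <= b - (0 < b))%N.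
  elim: l b => [|c l IH] b //= /andP [cb pl] /andP [c_gt0 al].
  by have := IH c pl al; move: cb; rewrite /gtn /=; lia.
elim: B sB pB => //= b l IH pl /andP [b_gt0 al].
have [pul bul] := IH (path_sorted pl) al.
have sb := size_lt b l pl al.
rewrite bul size_unbeta; split; last by congr (_ :: _); lia.
rewrite is_partition_cons pul andbT; apply/andP; split; first by lia.
case: l pl al bul sb {IH} pul => // c l /= /andP [cb pl] /andP [c_gt0 al] [bc _] sb.
rewrite is_partition_cons => /and3P [_ cl _]; rewrite /geq /=; apply/andP; split.
  by move: cb; rewrite /gtn /=; lia.
apply: sub_all cl => x; rewrite /geq /= => xc; move: cb; rewrite /gtn /=; lia.
Qed.

Lemma conj_partP la j l : is_partition la -> (0 < j)%N ->
  (l < conj_part la j)%N = (j <= nth 0 la l)%N.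
Proof.
move=> + j_gt0; rewrite /conj_part; elim: la l => [|a la IH] l.
  by move=> _ /=; rewrite nth_nil; lia.
rewrite is_partition_cons => /and3P [_ ala pla] /=.
case: (leqP j a) => ja /=.
  by case: l => [|l] /=; rewrite ?add1n ?ltnS ?ja ?IH.
have -> : count (leq j) la = 0%N.
  apply/eqP; rewrite -leqn0 leqNgt -has_count; apply/hasPn => x xl.
  by have /allP /(_ x xl) := ala; rewrite /geq /=; lia.
rewrite addn0 ltn0; apply/esym/negbTE; rewrite -ltnNge; case: l => [|l] //=.
have [ll|ll] := ltnP l (size la); last by rewrite nth_default.
by have /allP /(_ _ (mem_nth 0%N ll)) := ala; rewrite /geq /=; lia.
Qed.

Lemma conj_part_size la j : (conj_part la j <= size la)%N.
Proof. exact: count_size. Qed.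

(* The hook lengths in the row of the beta number b are the differences b - c
   over the c < b outside the beta set; column j corresponds to
   c = j - 1 + size la - conj_part la j. *)
Lemma is_coreP s la : (0 < s)%N -> is_partition la ->
  is_core s la <->
  (forall b, b \in beta_set la -> (s <= b)%N -> (b - s)%N \in beta_set la).
Proof.
move=> s_gt0 pla; have CP j l := @conj_partP la j l pla.
have sizeB := size_beta_set la.
have nthB i : (i < size la)%N -> nth 0%N (beta_set la) i = (nth 0 la i + (size la - i.+1))%N.
  exact: nth_beta_set.
split=> [core b /(nthP 0%N) [i]|H i j].
- rewrite sizeB => il bE sb; apply/negPn/negP => cB.
  have sorted_la l l' : (l <= l')%N -> (nth 0 la l' <= nth 0 la l)%N.
    move=> ll'; have [->//|n0] := posnP (nth 0 la l').
    by rewrite -CP // (leq_ltn_trans ll') // CP.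
  move: bE; rewrite nthB // => bE.
  (* [p] counts the beta numbers above the missing value b - s; it will be the length of column
     [j]. *)
  pose p := find (fun x => x < b - s)%N (beta_set la).
  have pk : (p <= size la)%N by rewrite -sizeB find_size.
  have below l : (l < p)%N -> (b - s < nth 0 la l + (size la - l.+1))%N.
    move=> lp; have lk := leq_trans lp pk; rewrite -nthB // ltn_neqAle leqNgt.
    rewrite (before_find 0%N lp) andbT; apply: contraNneq cB => ->.
    by rewrite mem_nth // sizeB.
  have above : (p < size la)%N -> (nth 0 la p + (size la - p.+1) < b - s)%N.
    move=> lpk; have := @nth_find _ 0%N (fun x => x < b - s)%N (beta_set la).
    by rewrite has_find sizeB -/p nthB //; apply.
  have pos l : (l < size la)%N -> (0 < nth 0 la l)%N.
    by move=> lk; have /andP [_ /allP] := pla; apply; rewrite mem_nth.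
  have ip : (i < p)%N.
    rewrite ltnNge; apply/negP => pi; have := above (leq_ltn_trans pi il).
    by have := sorted_la _ _ pi; lia.
  (* The solution of b - s = j - 1 + size la - p. *)
  pose j := ((b - s).+1 - (size la - p))%N.
  have j_gt0 : (0 < j)%N.
    rewrite /j; have [pk'|pk'] := ltnP p (size la); last by lia.
    by have := above pk'; have := pos _ pk'; lia.
  have conjE : conj_part la j = p.
    apply/eqP; rewrite eqn_leq; apply/andP; split.
      rewrite leqNgt CP // -ltnNge; have [pk'|pk'] := ltnP p (size la).
        by have := above pk'; rewrite /j; lia.
      by rewrite nth_default.
    have [->//|p_gt0] := posnP p.
    rewrite -(prednK p_gt0) CP // /j.
    by have := below p.-1; rewrite prednK // leqnn => /(_ isT); lia.
  have ji : (j <= nth 0 la i)%N by rewrite -CP // conjE.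
  apply: (core i.+1 j); first by rewrite /in_diagram /part /= il j_gt0 ji.
  by rewrite /hook_length /part conjE /= /j; move: ji; rewrite /j; lia.
- rewrite /in_diagram /hook_length /part => /and4P [i_gt0 il j_gt0 ji] hook.
  have ii : (i.-1 < size la)%N by lia.
  have ic : (i.-1 < conj_part la j)%N by rewrite CP.
  have cs := conj_part_size la j.
  have bE := nthB _ ii.
  have sb : (s <= nth 0 (beta_set la) i.-1)%N by rewrite bE; lia.
  have := H _ (mem_nth 0%N _) sb; rewrite sizeB => /(_ ii) /(nthP 0%N) [l].
  rewrite sizeB => ll; rewrite nthB // bE.
  (* The hook equation gives b - s = j - 1 + size la - conj_part la j. Beta numbers of rows meeting
     column j lie above this value, those of the other rows below it. *)
  have [lc|lc] := ltnP l (conj_part la j).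
    by have := lc; rewrite CP //; lia.
  have : ~~ (l < conj_part la j)%N by rewrite -leqNgt.
  by rewrite CP // -ltnNge; lia.
Qed.

(** * Cores as Dyck words *)

(** An abacus with s runners, in which runner j has beads exactly on its lowest [h j] levels. *)
Definition beta_of (s : nat) (h : nat -> nat) : seq nat :=
  sort geq [seq (q * s + j)%N | j <- iota 0 s, q <- iota 0 (h j)].

Lemma mem_beta_of s h x : (0 < s)%N -> (x \in beta_of s h) = (x %/ s < h (x %% s))%N.
Proof.
move=> s_gt0; rewrite mem_sort; apply/allpairsPdep/idP => [[j [q []]]|xh].
  rewrite !mem_iota !add0n => /= js qh ->.
  by rewrite divnMDl // modnMDl divn_small // modn_small // addn0.
exists (x %% s)%N, (x %/ s)%N; rewrite !mem_iota !add0n ltn_mod s_gt0 xh; split=> //.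
exact: divn_eq.
Qed.

Lemma beta_of_strict s h : (0 < s)%N -> sorted gtn (beta_of s h).
Proof.
move=> s_gt0; have tot : total geq by move=> x y; rewrite /geq /=; lia.
have uB : uniq (beta_of s h).
  rewrite sort_uniq; apply: allpairs_uniq_dep; rewrite ?iota_uniq //.
    by move=> j _; apply: iota_uniq.
  move=> p p' /allpairsPdep [j [q [+ _ ->]]] /allpairsPdep [j' [q' [+ _ ->]]] /=.
  rewrite !mem_iota !add0n => /= js js' E.
  have : j = j' by have := congr1 (modn^~ s) E; rewrite !modnMDl !modn_small.
  move=> <-; congr existT.
  by have := congr1 (divn^~ s) E; rewrite !divnMDl // !divn_small // !addn0.
have := sort_sorted tot [seq (q * s + j)%N | j <- iota 0 s, q <- iota 0 (h j)].
rewrite -/(beta_of s h); move: uB; elim: (beta_of s h) => //= x l IH /andP [xl ul] pl.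
have := IH ul (path_sorted pl); case: l xl pl {IH ul} => //= y l.
rewrite inE negb_or => /andP [xy _].
by move=> /andP [yx _] ->; rewrite andbT /gtn /=; move: yx; rewrite /geq /=; lia.
Qed.

Definition core_of (s : nat) (h : nat -> nat) : seq nat := unbeta (beta_of s h).

(** Runner 0 is empty because beta numbers are positive. The inequality is closure under subtracting
    s+1, which moves a bead from runner j+1 to runner j, one level down. *)
Definition height_condition (s : nat) (h : nat -> nat) : Prop :=
  h 0%N = 0%N /\ forall j, (j.+1 < s)%N -> (h j.+1 <= (h j).+1)%N.

Lemma core_ofP s h : (0 < s)%N -> height_condition s h ->
  core_partitions s s.+1 (core_of s h) /\ beta_set (core_of s h) = beta_of s h.
Proof.
move=> s_gt0 [h0 hS]; have sB := beta_of_strict h s_gt0.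
have pB : all (leq 1) (beta_of s h).
  apply/allP => -[|x] //; by rewrite mem_beta_of // div0n mod0n h0.
have [pla bE] := unbeta_partition sB pB; split=> //; split=> //.
rewrite !is_coreP // -/(core_of s h) bE; split=> x; rewrite !mem_beta_of // => xB sx.
  move: xB; rewrite -{1 2}(subnK sx) modnDr divnDr ?dvdnn // divnn s_gt0.
  by rewrite addn1; apply: ltnW.
have := divn_eq x s; have := ltn_pmod x s_gt0; move: xB.
case: (x %% s)%N => [|j]; first by rewrite h0.
move: (x %/ s)%N => q qh js xE.
have q_gt0 : (0 < q)%N by case: q xE {qh} => // xE; move: sx; rewrite xE; lia.
have -> : (x - s.+1 = q.-1 * s + j)%N by case: q q_gt0 xE {qh} => // q _; rewrite mulSn /=; lia.
rewrite divnMDl // modnMDl divn_small ?modn_small ?addn0; try by lia.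
by have := hS j js; lia.
Qed.

Lemma core_of_onto s la : (0 < s)%N -> core_partitions s s.+1 la ->
  exists2 h, height_condition s h & core_of s h = la.
Proof.
move=> s_gt0 [pla [/is_coreP C1 /is_coreP C2]].
have {C1}C1 := C1 s_gt0 pla; have {C2}C2 := C2 isT pla.
have /andP [sB pB] := beta_set_strict pla.
have le_sumn l b : (b \in l -> b <= sumn l)%N.
  by elim: l => //= c l IH; rewrite inE => /orP [/eqP ->|/IH]; lia.
pose B := beta_set la; pose P j q := (q * s + j)%N \notin B.
(* Numbers beyond the sum of the beta numbers are vacant, so each runner has a first vacant
   level. *)
have hasP j : has (P j) (iota 0 (sumn B).+2).
  apply/hasP; exists (sumn B).+1; first by rewrite mem_iota add0n ltnS leqnn.
  by rewrite /P; apply/negP => /le_sumn; nia.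
pose h j := find (P j) (iota 0 (sumn B).+2).
have h_lt j : (h j < (sumn B).+2)%N by have := hasP j; rewrite has_find size_iota.
(* Closure under subtracting s leaves no bead above the first vacancy. *)
have hE j q : (q * s + j \in B)%N = (q < h j)%N.
  have [qh|hq] := ltnP q (h j).
    have := before_find 0%N qh; rewrite nth_iota ?add0n ?(ltn_trans qh) //.
    by rewrite /P => /negbFE.
  apply/negbTE; have := nth_find 0%N (hasP j); rewrite -/(h j) nth_iota // add0n.
  rewrite /P -(subnK hq); elim: (q - h j)%N => // n IH /IH; apply: contra.
  rewrite addSn mulSn -addnA => /C1; rewrite leq_addr addKn; exact.
exists h.
  split.
    apply/eqP; rewrite -leqn0 leqNgt -hE mul0n; apply/negP => /(allP pB) //.
  move=> j js; rewrite leqNgt; apply/negP => lt_h.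
  have : ((h j).+1 * s + j.+1 \in B)%N by rewrite hE.
  have -> : ((h j).+1 * s + j.+1 = s.+1 + (h j * s + j))%N by rewrite mulSn; lia.
  move=> /C2.
  by rewrite leq_addr addKn => /(_ isT); rewrite -/B hE ltnn.
rewrite /core_of -[RHS]beta_setK; congr unbeta.
apply: (@irr_sorted_eq _ gtn) => //; rewrite ?beta_of_strict //.
- by move=> x y z; rewrite /gtn /=; lia.
- by move=> x; rewrite /gtn /= ltnn.
move=> x; rewrite mem_beta_of // -hE -divn_eq //.
Qed.

Lemma natr_bin2 n : 'C(n, 2)%:R = n%:R * (n%:R - 1) / 2 :> rat.
Proof.
elim: n => [|n IH]; first by rewrite bin0n !mul0r.
by rewrite binS bin1 natrD IH -natr1; field.
Qed.

(** The sum of the beta numbers, to which runner j contributes s C(h j, 2) + j (h j), minus C(m, 2)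
    for m beads in all. *)
Lemma partition_size_core_of s h : (0 < s)%N -> height_condition s h ->
  (partition_size (core_of s h))%:R =
  \sum_(j < s) (s%:R * ((h j)%:R * ((h j)%:R - 1) / 2) + j%:R * (h j)%:R)
  - (\sum_(j < s) (h j)%:R) * ((\sum_(j < s) (h j)%:R) - 1) / 2 :> rat.
Proof.
move=> s_gt0 hh; have [_ bE] := core_ofP s_gt0 hh.
have := sumn_beta_set (core_of s h); rewrite bE size_unbeta => /(congr1 (fun n => n%:R : rat)).
rewrite natrD natr_bin2.
have perm : perm_eq (beta_of s h) [seq (q * s + j)%N | j <- iota 0 s, q <- iota 0 (h j)].
  by rewrite perm_sort.
have -> : (size (beta_of s h))%:R = \sum_(j < s) (h j)%:R :> rat.
  rewrite (perm_size perm) size_allpairs_dep sumnE big_map natr_sum.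
  rewrite -[X in iota 0 X]subn0 -/(index_iota 0 s) big_mkord.
  by apply: eq_bigr => j _; rewrite size_iota.
have -> : (sumn (beta_of s h))%:R =
    \sum_(j < s) (s%:R * ((h j)%:R * ((h j)%:R - 1) / 2) + j%:R * (h j)%:R) :> rat.
  rewrite (perm_sumn perm) sumnE big_allpairs_dep /= natr_sum.
  rewrite -[X in iota 0 X]subn0 -/(index_iota 0 s) big_mkord.
  apply: eq_bigr => j _; rewrite natr_sum.
  elim: (h j : nat) => [|n IH]; first by rewrite big_nil; ring.
  by rewrite -addn1 iotaD big_cat big_seq1 /= IH add0n !natrD natrM; field.
by move=> ->; rewrite /partition_size addrK.
Qed.

(** * The bijection between Dyck words and cores *)

(** For a Dyck word in [words s s.+1] and j < s the subtraction is exact, and up step j starts at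
    height s h + j with h this value: the first vacant position of runner j. *)
Definition word_heights (w : seq bool) (j : nat) : nat :=
  (j - nth 0 (falses_before 0 w) j)%N.

Definition core_of_word (s : nat) (w : seq bool) : seq nat := core_of s (word_heights w).

Lemma word_heights_condition s w : (0 < s)%N -> w \in words s s.+1 -> dyck s w ->
  height_condition s (word_heights w).
Proof.
move=> s_gt0 ww dw; split; first by rewrite /word_heights sub0n.
move=> j js; have wd := (dyck_falses_before ww).1 dw.
have : (nth 0 (falses_before 0 w) j <= nth 0 (falses_before 0 w) j.+1)%N.
  apply: (sorted_leq_nth leq_trans leqnn 0%N (falses_before_sorted 0 w)) => //;
  rewrite inE size_falses_before; move: ww; rewrite mem_words => /andP [/eqP -> _] //.
  exact: ltnW.
by have := wd j (ltnW js); have := wd _ js; rewrite /word_heights; lia.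
Qed.

Lemma core_of_word_inj s : (0 < s)%N ->
  {in [pred w | (w \in words s s.+1) && dyck s w] &, injective (core_of_word s)}.
Proof.
move=> s_gt0 w1 w2 /andP [ww1 d1] /andP [ww2 d2] E.
have [_ E1] := core_ofP s_gt0 (word_heights_condition s_gt0 ww1 d1).
have [_ E2] := core_ofP s_gt0 (word_heights_condition s_gt0 ww2 d2).
have {E E1 E2} EB : beta_of s (word_heights w1) = beta_of s (word_heights w2).
  by rewrite -E1 -E2 -/(core_of_word s w1) E.
have Eh j : (j < s)%N -> word_heights w1 j = word_heights w2 j.
  move=> js; have H q : (q < word_heights w1 j)%N = (q < word_heights w2 j)%N.
    have := mem_beta_of (word_heights w1) (q * s + j) s_gt0; rewrite EB mem_beta_of //.
    by rewrite divnMDl // modnMDl divn_small // modn_small // addn0 => ->.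
  by apply/eqP; rewrite eqn_leq leqNgt H ltnn leqNgt -H ltnn.
(* The Dyck bounds make the subtraction exact, so equal bead counts give equal numbers of preceding
   down steps. *)
have w1d := (dyck_falses_before ww1).1 d1; have w2d := (dyck_falses_before ww2).1 d2.
move: ww1 ww2; rewrite !mem_words => /andP [/eqP c1 /eqP n1] /andP [/eqP c2 /eqP n2].
apply: (@falses_before_inj 0); first by rewrite n1 n2.
apply: (@eq_from_nth _ 0%N); first by rewrite !size_falses_before c1 c2.
move=> j; rewrite size_falses_before c1 => js.
by have := Eh j js; have := w1d j js; have := w2d j js; rewrite /word_heights; lia.
Qed.

Lemma core_of_ext s h h' : (forall j, (j < s)%N -> h j = h' j) -> core_of s h = core_of s h'.
Proof.
move=> E; congr unbeta; congr (sort _ (flatten _)); apply/eq_in_map => j.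
by rewrite mem_iota add0n => /= js; rewrite E.
Qed.

Lemma core_of_word_onto s la : (0 < s)%N -> core_partitions s s.+1 la ->
  exists2 w, (w \in words s s.+1) && dyck s w & core_of_word s w = la.
Proof.
move=> s_gt0 /(core_of_onto s_gt0) [h [h0 hS] <-].
have hj j : (j < s)%N -> (h j <= j)%N.
  by elim: j => [|j IH] js; [rewrite h0|have := hS j js; have := IH (ltnW js); lia].
(* Inverts [word_heights]: h j <= j keeps the subtraction exact, and h (j+1) <= h j + 1 makes [l]
   weakly increasing. *)
pose l := mkseq (fun j => j - h j)%N s.
have [] := @falses_before_onto 0 s.+1 l.
- rewrite -(mkseq_nth 0%N l); apply/(pathP 0%N) => j; rewrite !size_mkseq => js.
  case: j js => [|j] js //=.
  by rewrite !nth_mkseq ?size_mkseq //; try (by lia); have := hS j js; have := hj _ (ltnW js); lia.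
- apply/allP => x /mapP [j]; rewrite mem_iota => /= js ->; lia.
- by [].
move=> w wl; rewrite add0n => wt.
have ww : w \in words s s.+1.
  by rewrite mem_words wt eqxx andbT -(size_falses_before 0) wl size_mkseq.
exists w.
  rewrite ww; apply/(dyck_falses_before ww) => j js; rewrite wl nth_mkseq // leq_subr //.
apply: core_of_ext => j js; rewrite /word_heights wl nth_mkseq // subKn // hj //.
Qed.

Lemma sumr_ord n : \sum_(j < n) j%:R = n%:R * (n%:R - 1) / 2 :> rat.
Proof.
elim: n => [|n IH]; first by rewrite big_ord0; ring.
by rewrite big_ord_recr IH /= -natr1; field.
Qed.

Lemma sumr_ord_sqr n : \sum_(j < n) j%:R ^+ 2 = n%:R * (n%:R - 1) * (2 * n%:R - 1) / 6 :> rat.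
Proof.
elim: n => [|n IH]; first by rewrite big_ord0; ring.
by rewrite big_ord_recr IH /= -natr1; field.
Qed.

(** As up step j starts at s h_j + j, expanding the squares in [deviation_up] turns both sides into
    the same quadratic expression in the bead counts h_j. *)
Lemma deviation_core_of_word s w : (0 < s)%N -> w \in words s s.+1 -> dyck s w ->
  deviation s s.+1 w =
  (partition_size (core_of_word s w))%:R - s%:R * (s%:R ^+ 2 - 1) / 12.
Proof.
move=> s_gt0 ww dw; rewrite deviation_up //.
have s0 : s%:R != 0 :> rat by rewrite pnatr_eq0 -lt0n.
rewrite partition_size_core_of //; last exact: word_heights_condition.
have wd := (dyck_falses_before ww).1 dw.
have U k : up_sum s.+1%:R s%:R k 0 w =
    \sum_(j < s) (s%:R * (word_heights w j)%:R + j%:R) ^+ k.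
  rewrite (up_sum_falses_before _ _ _ _ 0); move: ww; rewrite mem_words => /andP [/eqP -> _].
  apply: eq_bigr => j _; congr (_ ^+ k).
  by rewrite /word_heights natrB ?wd // -natr1; ring.
rewrite !U; set h := fun j => (word_heights w j)%:R : rat.
have -> : \sum_(j < s) (s%:R * h j + j%:R) ^+ 2 =
  s%:R ^+ 2 * (\sum_(j < s) h j ^+ 2) + 2 * s%:R * (\sum_(j < s) j%:R * h j)
  + \sum_(j < s) j%:R ^+ 2.
  by rewrite !mulr_sumr -!big_split /=; apply: eq_bigr => j _; ring.
have -> : \sum_(j < s) (s%:R * h j + j%:R) ^+ 1 = s%:R * (\sum_(j < s) h j) + \sum_(j < s) j%:R.
  by rewrite !mulr_sumr -!big_split /=; apply: eq_bigr => j _; ring.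
have -> : \sum_(j < s) (s%:R * (h j * (h j - 1) / 2) + j%:R * h j) =
  s%:R / 2 * (\sum_(j < s) h j ^+ 2) - s%:R / 2 * (\sum_(j < s) h j) + \sum_(j < s) j%:R * h j.
  by rewrite !mulr_sumr -sumrN -!big_split /=; apply: eq_bigr => j _; ring.
rewrite sumr_ord sumr_ord_sqr natrD -natr1.
move: (\sum_(j < s) h j) (\sum_(j < s) h j ^+ 2) (\sum_(j < s) j%:R * h j) => H1 H2 J.
by field.
Qed.

(** * The moments of the size of a core *)

(** Lets large decimal literals be handled in binary instead of unary. *)
Lemma natr_num_uint d : (Nat.of_num_uint d)%:R = ratZ (Z.of_num_uint d).
Proof.
by rewrite /ratZ (common.large_nat_Z_int (common.large_nat_uint d)).
Qed.

Definition seventh_moment_polyZ (s : Z) : Z :=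
  (124496 * powZ s 14 - 527660 * powZ s 13 - 127268 * powZ s 12
  + 2133077 * powZ s 11 + 1565655 * powZ s 10 - 3928575 * powZ s 9
  - 7848989 * powZ s 8 - 3573289 * powZ s 7 + 7257797 * powZ s 6
  + 16741975 * powZ s 5 + 16528197 * powZ s 4 + 3583272 * powZ s 3
  - 67819248 * powZ s 2 - 18541440 * s + 138620160)%stdZ.

Lemma ratZ_add x y a b : ratZ x = a -> ratZ y = b -> ratZ (x + y)%stdZ = a + b.
Proof. by move=> <- <-; apply: ratZD. Qed.

Lemma ratZ_sub x y a b : ratZ x = a -> ratZ y = b -> ratZ (x - y)%stdZ = a - b.
Proof. by move=> <- <-; apply: ratZB. Qed.

Lemma ratZ_mul x y a b : ratZ x = a -> ratZ y = b -> ratZ (x * y)%stdZ = a * b.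
Proof. by move=> <- <-; apply: ratZM. Qed.

Lemma ratZ_pow x a k : ratZ x = a -> ratZ (powZ x k) = a ^+ k.
Proof. by move=> <-; apply: ratZX. Qed.

(* Rewriting with the morphism lemmas would make the unifier evaluate the
   large constants in unary. *)
Ltac morph_ratZ := repeat match goal with
  | |- ratZ (Z.add _ _) = _ => refine (ratZ_add _ _)
  | |- ratZ (Z.sub _ _) = _ => refine (ratZ_sub _ _)
  | |- ratZ (Z.mul _ _) = _ => refine (ratZ_mul _ _)
  | |- ratZ (powZ _ _) = _ => refine (ratZ_pow _ _)
  | |- ratZ _ = (Nat.of_num_uint ?d)%:R => exact (esym (natr_num_uint d))
  | |- ratZ (Z.of_nat _) = _ => exact (ratZ_nat _)
  | |- ratZ ?x = ratZ ?x => exact (erefl _)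
  end.

Lemma seventh_moment_polyZE s a : ratZ s = a ->
  ratZ (seventh_moment_polyZ s) = seventh_moment_poly a.
Proof.
by move=> <-; rewrite /seventh_moment_polyZ /seventh_moment_poly; morph_ratZ.
Qed.

(** A polynomial identity in s once the powers are unfolded. The factor 8 is the quotient of the
    denominators 1195587993600 and 149448499200. *)
Lemma moment7Z_diag (s : Z) : moment7Z s (s + 1)%stdZ =
  (8 * powZ s 2 * (s - 1) * (s - 2) * (2 * s + 1) * powZ (s + 1) 2
   * seventh_moment_polyZ s)%stdZ.
Proof.
rewrite /moment7Z /seventh_moment_polyZ /moment7_coefs /powZ; cbn [iter foldr fst snd].
by lia.
Qed.

Lemma ratZ_moment7Z_diag s : ratZ (moment7Z (Z.of_nat s) (Z.of_nat s.+1)) =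
  8 * s%:R ^+ 2 * (s%:R - 1) * (s%:R - 2) * (2 * s%:R + 1) * (s%:R + 1) ^+ 2
  * seventh_moment_poly s%:R.
Proof.
have -> : Z.of_nat s.+1 = (Z.of_nat s + 1)%stdZ by lia.
rewrite moment7Z_diag; refine (ratZ_mul _ (seventh_moment_polyZE (ratZ_nat s))).
by morph_ratZ.
Qed.

Lemma ratZ_moment7_den : ratZ 1195587993600%stdZ = 8 * 149448499200%:R.
Proof.
have -> : 1195587993600%stdZ = (8 * 149448499200)%stdZ by [].
by morph_ratZ.
Qed.

Lemma moment7_diag s : moment7 s%:R s.+1%:R =
  1 / 149448499200%:R
    * s%:R ^+ 2 * (s%:R - 1) * (s%:R - 2) * (2 * s%:R + 1) * (s%:R + 1) ^+ 2
    * seventh_moment_poly s%:R.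
Proof.
have solve (c x P m : rat) : c != 0 ->
    8 * x ^+ 2 * (x - 1) * (x - 2) * (2 * x + 1) * (x + 1) ^+ 2 * P = m * (8 * c) ->
    m = 1 / c * x ^+ 2 * (x - 1) * (x - 2) * (2 * x + 1) * (x + 1) ^+ 2 * P.
  move=> c0 E; have e0 : 8 * c != 0 by rewrite mulf_neq0.
  by apply: (mulIf e0); rewrite -E; field.
have := moment7ZE (Z.of_nat s) (Z.of_nat s.+1).
rewrite ratZ_moment7Z_diag !ratZ_nat ratZ_moment7_den; apply: solve.
by rewrite natr_num_uint; exact: (@ratZ_neq0 149448499200%stdZ isT).
Qed.

Lemma core_partitions_words s : (0 < s)%N ->
  core_partitions s s.+1 =
  [set` [seq core_of_word s w | w <- words s s.+1 & dyck s w]]%classic.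
Proof.
move=> s_gt0; apply/seteqP; split=> la.
  move=> /(core_of_word_onto s_gt0) [w /andP [ww dw] <-].
  by apply/mapP; exists w; rewrite // mem_filter dw.
move=> /mapP [w]; rewrite mem_filter => /andP [dw ww] ->.
by have [] := core_ofP s_gt0 (word_heights_condition s_gt0 ww dw).
Qed.

Lemma finite_core_partitions s : (0 < s)%N -> finite_set (core_partitions s s.+1).
Proof. by move=> s_gt0; apply/finite_seqP; eexists; apply: core_partitions_words. Qed.

(** Dyck words enumerate the cores, each word has exactly one Dyck rotation, and rotation preserves
    the deviation; so the average over cores is the average over all words. *)
Lemma uniform_expectation_cores s (f : seq nat -> rat) (g : rat -> rat) : (0 < s)%N ->
  (forall w, w \in words s s.+1 -> dyck s w -> f (core_of_word s w) = g (deviation s s.+1 w)) ->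
  uniform_expectation (core_partitions s s.+1) f =
  (\sum_(w <- words s s.+1) g (deviation s s.+1 w)) / 'C(s + s.+1, s)%:R.
Proof.
move=> s_gt0 fg; pose L := [seq core_of_word s w | w <- words s s.+1 & dyck s w].
have perm : perm_eq (fset_set (core_partitions s s.+1)) L.
  apply: uniq_perm; rewrite ?fset_uniq //.
    rewrite map_inj_in_uniq ?filter_uniq ?uniq_words // => w1 w2.
    rewrite !mem_filter => /andP [d1 ww1] /andP [d2 ww2].
    by apply: core_of_word_inj; rewrite ?inE ?ww1 ?ww2.
  move=> la; rewrite in_fset_set; last exact: finite_core_partitions.
  by rewrite core_partitions_words // mem_setE.
have rotE (F : rat -> rat) :
    (s + s.+1)%:R * \sum_(w <- words s s.+1 | dyck s w) F (deviation s s.+1 w)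
    = \sum_(w <- words s s.+1) F (deviation s s.+1 w).
  rewrite (@sum_rotations (fun w => F (deviation s s.+1 w)) _ s s.+1 1) ?mul1r //.
    by move=> w ww; rewrite deviation_rot.
  exact: cycle_lemma.
have N0 : (s + s.+1)%:R != 0 :> rat by rewrite pnatr_eq0 addnS.
rewrite /uniform_expectation (perm_big _ perm) (perm_size perm) big_map big_filter.
rewrite -[RHS]/(_ / _) -rotE.
(* The constant function 1 in [rotE] counts the cores: C(2s+1, s)/(2s+1), a Catalan number. *)
have -> : 'C(s + s.+1, s)%:R = (s + s.+1)%:R * (size L)%:R :> rat.
  have := rotE (fun=> 1); rewrite !big_const_seq !iter_addr_0 count_predT size_words => <-.
  by rewrite size_map size_filter.
rewrite -mulf_div divff // mul1r; congr (_ / _).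
rewrite big_seq_cond [RHS]big_seq_cond; apply: eq_bigr => w /andP [ww dw].
exact: fg.
Qed.

Unset Implicit Arguments.

Theorem theorem7 (s : nat) (hs : (0 < s)%N) :
  finite_set (core_partitions s s.+1) /\
  central_moment (core_partitions s s.+1)
    (fun la : seq nat => (partition_size la)%:R) 7 =
  1 / 149448499200%:R
    * s%:R ^+ 2 * (s%:R - 1) * (s%:R - 2) * (2 * s%:R + 1) * (s%:R + 1) ^+ 2
    * seventh_moment_poly s%:R.
Proof.
split; first exact: finite_core_partitions.
(* [mu] will be the mean, because the first moment of the deviation vanishes. *)
pose mu : rat := s%:R * (s%:R ^+ 2 - 1) / 12.
have devE w : w \in words s s.+1 -> dyck s w ->
    (partition_size (core_of_word s w))%:R = deviation s s.+1 w + mu.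
  by move=> ww dw; rewrite deviation_core_of_word // subrK.
rewrite /central_moment -moment7_diag -deviation_moment7 //.
have -> : uniform_expectation (core_partitions s s.+1)
    (fun la : seq nat => (partition_size la)%:R) = mu.
  rewrite (@uniform_expectation_cores _ _ (fun x => x + mu)) // big_split /= mulrDl.
  have -> : (\sum_(w <- words s s.+1) deviation s s.+1 w) / 'C(s + s.+1, s)%:R = 0.
    exact: (deviation_moment1_eq0 s.+1 hs).
  rewrite big_const_seq iter_addr_0 count_predT size_words add0r -[mu *+ _]mulr_natr mulfK //.
  by rewrite pnatr_eq0 -lt0n bin_gt0 leq_addr.
apply: (@uniform_expectation_cores _ _ (fun x => x ^+ 7)) => // w ww dw.
by rewrite devE // addrK.
Qed.
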